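(* The following problem is undecidable: given a labeled one-clock priced timed automaton $\mathcal{A}$ with a single cost function (with arbitrary rates in $\mathbb{N}$) and a WMTL formula $\varphi$, decide whether there exists a finite run of $\mathcal{A}$ starting in the initial state $(q_0,0)$ that satisfies $\varphi$.
   Context: A priced timed automaton (PTA) is $\mathcal{A}=(Q,q_0,X,E,\mathrm{Inv},(\mathrm{cost}_i)_i)$: finite locations $Q$, initial $q_0$, clocks $X$ (here one clock), transitions $E\subseteq Q\times\mathcal{C}(X)\times2^X\times Q$ with clock constraints $g::=x\sim c\mid g\wedge g$ ($c\in\mathbb{N}$, $\sim\in\{<,\le,=,\ge,>\}$), invariants $\mathrm{Inv}:Q\to\mathcal{C}(X)$, cost functions $\mathrm{cost}_i:Q\cup E\to\mathbb{N}$; labeled by $\ell:Q\to2^{AP}$. Semantics: discrete moves $(q,v)\xrightarrow{e}(q',v')$ for $e=(q,g,R,q')$ with $v\models g$, $v'=v[R\leftarrow0]$, $v'\models\mathrm{Inv}(q')$, costing $\mathrm{cost}_i(e)$; delay moves $(q,v)\xrightarrow{t}(q,v+t)$ if the invariant holds throughout, costing $t\cdot\mathrm{cost}_i(q)$. A mixed move is a delay followed by a discrete move; a finite run $\varrho$ is a sequence of mixed moves with length $|\varrho|$, prefixes $\varrho_{\le\pi}$, suffixes $\varrho_{\ge\pi}$, and costs given by sums. WMTL: $\varphi::=a\mid\neg\varphi\mid\varphi\vee\varphi\mid\varphi\mathsf{U}_{\mathrm{cost}\sim c}\varphi$ over finite runs: $\varrho\models a$ iff $a$ labels the first location of $\varrho$;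 Boolean cases as usual; $\varrho\models\varphi_1\mathsf{U}_{\mathrm{cost}\sim c}\varphi_2$ iff there is $0<\pi\le|\varrho|$ with $\varrho_{\ge\pi}\models\varphi_2$, $\varrho_{\ge\pi'}\models\varphi_1$ for all $0<\pi'<\pi$, and $\mathrm{cost}(\varrho_{\le\pi})\sim c$. *)

(* Defs.v *)
From HB Require Import structures.
From mathcomp Require Import all_boot all_order all_algebra.
From mathcomp Require Import reals.

Set Implicit Arguments.
Unset Strict Implicit.
Unset Printing Implicit Defensive.

Import Order.TTheory GRing.Theory Num.Theory.
Local Open Scope ring_scope.

Inductive recf : nat -> Type :=
| RZero n : recf n
| RSucc : recf 1
| RProj n (i : 'I_n) : recf n
| RComp m n (f : recf m) (g : 'I_m -> recf n) : recf n
| RPrec n (f : recf n) (g : recf n.+2) : recf n.+1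
| RMu n (f : recf n.+1) : recf n.

(* [eval f v y]: f is defined on v, with value y.  The recursion and search
   variable is the first argument. *)
Fixpoint eval n (f : recf n) : n.-tuple nat -> nat -> Prop :=
  match f in recf n return n.-tuple nat -> nat -> Prop with
  | RZero _ => fun _ y => y = 0%N
  | RSucc => fun v y => y = (thead v).+1
  | RProj _ i => fun v y => y = tnth v i
  | RComp m _ f g => fun v y =>
      exists w : m.-tuple nat, (forall i, eval (g i) v (tnth w i)) /\ eval f w y
  | RPrec _ f g => fun v y =>
      exists s : nat -> nat,
        [/\ eval f (behead_tuple v) (s 0%N),
            forall k, (k < thead v)%N ->
              eval g [tuple of k :: s k :: behead_tuple v] (s k.+1)
          & y = s (thead v)]
  | RMu _ f => fun v y =>
      eval f [tuple of y :: v] 0%N /\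
      forall k, (k < y)%N -> exists z, eval f [tuple of k :: v] z.+1
  end.

(* f is unconstrained on numbers that encode no instance.  This is the usual
   notion when the range of enc is a recursive set, as for [enc_instance]. *)
Definition decidable_problem (T : Type) (enc : T -> nat) (P : T -> Prop) : Prop :=
  exists f : recf 1, forall x : T,
    (P x -> eval f [tuple enc x] 1%N) /\ (~ P x -> eval f [tuple enc x] 0%N).

Definition undecidable_problem (T : Type) (enc : T -> nat) (P : T -> Prop) : Prop :=
  ~ decidable_problem enc P.

Inductive cmp := CLt | CLe | CEq | CGe | CGt.

Definition cmp_holds (R : realType) (o : cmp) (x : R) (c : nat) : Prop :=
  match o with
  | CLt => x < c%:R
  | CLe => x <= c%:R
  | CEq => x = c%:R
  | CGe => x >= c%:R
  | CGt => x > c%:R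
  end.

Inductive constraint :=
| CAtom of cmp & nat
| CAnd of constraint & constraint.

Definition cmp_eq_dec (o1 o2 : cmp) : {o1 = o2} + {o1 <> o2}.
Proof. decide equality. Defined.
HB.instance Definition _ := hasDecEq.Build cmp (compareP cmp_eq_dec).

Definition constraint_eq_dec (g1 g2 : constraint) : {g1 = g2} + {g1 <> g2}.
Proof. decide equality; [exact: eq_comparable | exact: cmp_eq_dec]. Defined.
HB.instance Definition _ := hasDecEq.Build constraint (compareP constraint_eq_dec).

Fixpoint csat (R : realType) (v : R) (g : constraint) : Prop :=
  match g with
  | CAtom o c => cmp_holds o v c
  | CAnd g1 g2 => csat v g1 /\ csat v g2
  end.

(* (source, guard, is the clock reset?, target) *)
Definition edge (n : nat) : Type := ('I_n * constraint * bool * 'I_n)%type.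

(* Atomic propositions are natural numbers.  [trans] lists the finite set of
   transitions, each paired with its cost; by [trans_uniq] the cost is a
   function of the transition. *)
Record pta := PTA {
  nloc : nat;
  init : 'I_nloc;
  inv : {ffun 'I_nloc -> constraint};
  rate : {ffun 'I_nloc -> nat};
  label : {ffun 'I_nloc -> seq nat};
  trans : seq (edge nloc * nat);
  trans_uniq : uniq (unzip1 trans)
}.

Definition edges (A : pta) : seq (edge (nloc A)) := unzip1 (trans A).

Definition edge_cost (A : pta) (e : edge (nloc A)) : nat :=
  nth 0%N (unzip2 (trans A)) (index e (edges A)).

Section Semantics.
Variables (R : realType) (A : pta).

Definition state : Type := ('I_(nloc A) * R)%type.

Definition delay_move (s : state) (t : R) (s' : state) : Prop :=
  [/\ 0 <= t,
      forall u, 0 <= u <= t -> csat (s.2 + u) (inv A s.1)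
    & s' = (s.1, s.2 + t)].

Definition discrete_move (s : state) (e : edge (nloc A)) (s' : state) : Prop :=
  let: (q, g, reset, q') := e in
  [/\ e \in edges A, s.1 = q, csat s.2 g,
      s' = (q', if reset then 0 else s.2) & csat s'.2 (inv A q')].

Definition mixed_move (s : state) (t : R) (e : edge (nloc A)) (s' : state) : Prop :=
  exists2 s1, delay_move s t s1 & discrete_move s1 e s'.

(* A step records the delay, the transition and the state reached. *)
Definition step : Type := (R * edge (nloc A) * state)%type.

Record run := Run { start : state; steps : seq step }.

Fixpoint valid_steps (s : state) (w : seq step) : Prop :=
  match w with
  | [::] => True
  | (t, e, s') :: w' => mixed_move s t e s' /\ valid_steps s' w'
  end.

Definition is_run (r : run) : Prop := valid_steps (start r) (steps r).

Fixpoint steps_cost (s : state) (w : seq step) : R :=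
  match w with
  | [::] => 0
  | (t, e, s') :: w' =>
      t * (rate A s.1)%:R + (edge_cost e)%:R + steps_cost s' w'
  end.

Definition run_cost (r : run) : R := steps_cost (start r) (steps r).

Definition run_length (r : run) : nat := size (steps r).

Definition run_prefix (r : run) (k : nat) : run :=
  Run (start r) (take k (steps r)).

Definition run_suffix (r : run) (k : nat) : run :=
  Run (last (start r) (unzip2 (take k (steps r)))) (drop k (steps r)).

End Semantics.

Inductive wmtl :=
| WAtom of nat
| WNot of wmtl
| WOr of wmtl & wmtl
| WUntil of wmtl & cmp & nat & wmtl.

Fixpoint wsat (R : realType) (A : pta) (r : run R A) (phi : wmtl) : Prop :=
  match phi with
  | WAtom a => a \in label A (start r).1
  | WNot p => ~ wsat r p
  | WOr p1 p2 => wsat r p1 \/ wsat r p2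
  | WUntil p1 o c p2 =>
      exists k, [/\ (0 < k <= run_length r)%N,
        wsat (run_suffix r k) p2,
        forall j, (0 < j < k)%N -> wsat (run_suffix r j) p1
      & cmp_holds o (run_cost (run_prefix r k)) c]
  end.

Definition wmtl_realizable (R : realType) (x : pta * wmtl) : Prop :=
  exists r : run R x.1, [/\ start r = (init x.1, 0), is_run r & wsat r x.2].

(* [CodeSeq.code] is the bijection from finite sequences of naturals to
   naturals given by [code (n :: s) = 2 ^ n * (2 * code s + 1)]. *)

Local Notation code := CodeSeq.code.

Definition enc_cmp (o : cmp) : nat :=
  match o with CLt => 0 | CLe => 1 | CEq => 2 | CGe => 3 | CGt => 4 end.

Fixpoint enc_constraint (g : constraint) : nat :=
  match g with
  | CAtom o c => code [:: 0; enc_cmp o; c]%N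
  | CAnd g1 g2 => code [:: 1; enc_constraint g1; enc_constraint g2]%N
  end.

Definition enc_trans (n : nat) (x : edge n * nat) : nat :=
  let: (q, g, reset, q', c) := x in
  code [:: val q; enc_constraint g; nat_of_bool reset; val q'; c].

Definition enc_pta (A : pta) : nat :=
  code [:: nloc A; val (init A);
           code [seq enc_constraint (inv A q) | q : 'I_(nloc A)];
           code [seq rate A q | q : 'I_(nloc A)];
           code [seq code (label A q) | q : 'I_(nloc A)];
           code [seq enc_trans x | x <- trans A]].

Fixpoint enc_wmtl (phi : wmtl) : nat :=
  match phi with
  | WAtom a => code [:: 0; a]%N
  | WNot p => code [:: 1; enc_wmtl p]%N
  | WOr p1 p2 => code [:: 2; enc_wmtl p1; enc_wmtl p2]%N
  | WUntil p1 o c p2 => code [:: 3; enc_wmtl p1; enc_cmp o; c; enc_wmtl p2]%N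
  end.

Definition enc_instance (x : pta * wmtl) : nat :=
  code [:: enc_pta x.1; enc_wmtl x.2].

Lemma code_inj : injective code.
Proof. exact: can_inj CodeSeq.codeK. Qed.

Lemma enc_cmp_inj : injective enc_cmp.
Proof. by do 2!case. Qed.

Lemma enc_constraint_inj : injective enc_constraint.
Proof.
elim=> [o c|g1 IH1 g2 IH2] [o' c'|g1' g2'] /code_inj; try by case.
  by case=> /enc_cmp_inj -> ->.
by case=> /IH1 -> /IH2 ->.
Qed.

Lemma enc_wmtl_inj : injective enc_wmtl.
Proof.
elim=> [a|p IH|p1 IH1 p2 IH2|p1 IH1 o c p2 IH2]
  [a'|p'|p1' p2'|p1' o' c' p2'] /code_inj; try by case.
- by case=> ->.
- by case=> /IH ->.
- by case=> /IH1 -> /IH2 ->.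
- by case=> /IH1 -> /enc_cmp_inj -> -> /IH2 ->.
Qed.

Lemma enc_trans_inj n : injective (@enc_trans n).
Proof.
move=> [[[[q g] r] q'] c] [[[[p h] s] p'] d] /code_inj.
case=> /ord_inj -> /enc_constraint_inj -> rs /ord_inj -> ->.
by case: r s rs => [] [].
Qed.

Lemma image_ffun_inj n (T : Type) (U : eqType) (h : T -> U) (f g : {ffun 'I_n -> T}) :
  injective h -> [seq h (f q) | q : 'I_n] = [seq h (g q) | q : 'I_n] -> f = g.
Proof.
move=> h_inj /eq_in_map E; apply/ffunP => q; apply: h_inj.
by apply: E; rewrite mem_enum.
Qed.

Lemma enc_pta_inj : injective enc_pta.
Proof.
move=> [n i v r l t tu] [n' i' v' r' l' t' tu'] /code_inj /= [En].
case: _ / En i' v' r' l' t' tu' => i' v' r' l' t' tu'.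
case=> /ord_inj <- /code_inj /(image_ffun_inj enc_constraint_inj) <-.
move=> /code_inj /(image_ffun_inj (@inj_id nat)) <-.
move=> /code_inj /(image_ffun_inj code_inj) <-.
move=> /code_inj /(inj_map (@enc_trans_inj n)) Et.
by case: _ / Et tu' => tu'; rewrite (bool_irrelevance tu tu').
Qed.

Lemma enc_instance_inj : injective enc_instance.
Proof.
by move=> [A p] [B q] /code_inj [] /enc_pta_inj -> /enc_wmtl_inj ->.
Qed.

(* Main.v *)
Require Import Defs.
From mathcomp Require Import all_boot all_order all_algebra.
From mathcomp Require Import reals.
From HB Require Import structures.
From mathcomp Require Import boolp zify ring lra.

Set Implicit Arguments.
Unset Strict Implicit.
Unset Printing Implicit Defensive.

Import Order.TTheory GRing.Theory Num.Theory.

(** The value c of a counter is stored as a clock value 2^-c.  A machine with K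
    counters is simulated in rounds of K blocks, one block per counter and one
    round per executed instruction.  A block starts in a location S of rate 2
    with clock 0, moves to a location E at clock value y, the stored value, then
    at clock value 1 to a location G, and waits there for an arbitrary time.  E
    has rate w = 1, 4 or 2, according to whether the instruction increments,
    decrements or preserves the counter.  The formula demands cost 7 between
    consecutive entries of E, and cost 7K - w from every entry of G to some
    later entry of S.  Together these force 2y' = wy, where y' is the value
    stored in the block of the same counter in the next round, so y = 2^-c
    becomes 2^-(c+1), 2^-(c-1) or 2^-c.  Guards y = 1 and y < 1 are zero tests.
    The input n is loaded by an initial loop which increments counter 0; since
    every round costs 7K, a single cost constraint of the formula fixes the
    number of iterations.

    Only the formula depends on n, so for a fixed automaton A the code of the
    instance is an easy function of n and K.  A decider f composed with this
    function compiles to a machine which halts on n iff f answers 0 on the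
    instance; for A built from this very machine and n the code of A, the
    instance has a satisfying run iff f answers 0 on it. *)

(** * Computable functions *)

Definition computable n (F : n.-tuple nat -> nat) : Prop :=
  exists g : recf n, forall v, eval g v (F v).

Lemma computable_comp m n (H : m.-tuple nat -> nat)
    (F : 'I_m -> n.-tuple nat -> nat) :
  computable H -> (forall i, computable (F i)) ->
  computable (fun v => H [tuple F i v | i < m]).
Proof.
move=> [h hP] /choice [g gP]; exists (RComp h g) => v /=.
by exists [tuple F i v | i < m]; split=> // i; rewrite tnth_mktuple.
Qed.

(** The witness for [RPrec] is [H] itself along its first argument: the two equations say that [H]
    is the function defined by the recursion. *)
Lemma computable_rec n (F : n.-tuple nat -> nat) (G : n.+2.-tuple nat -> nat)
    (H : n.+1.-tuple nat -> nat) :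
  computable F -> computable G ->
  (forall v : n.-tuple nat, H [tuple of 0 :: v] = F v) ->
  (forall k (v : n.-tuple nat), H [tuple of k.+1 :: v] =
     G [tuple of k :: H [tuple of k :: v] :: v]) ->
  computable H.
Proof.
move=> [f fP] [g gP] H0 HS; exists (RPrec f g) => v /=.
exists (fun k => H [tuple of k :: behead_tuple v]); split.
- by rewrite H0.
- by move=> k _; rewrite HS.
- by rewrite {1}(tuple_eta v).
Qed.

Lemma computable_nth n i : computable (fun v : n.-tuple nat => nth 0 v i).
Proof.
have [lt_in|le_ni] := ltnP i n.
  by exists (RProj (Ordinal lt_in)) => v /=; rewrite (tnth_nth 0).
by exists (RZero n) => v /=; rewrite nth_default ?size_tuple.
Qed.

Lemma computable_succ n (F : n.-tuple nat -> nat) :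
  computable F -> computable (fun v => (F v).+1).
Proof.
move=> cF; have cS : computable (fun v : 1.-tuple nat => (thead v).+1).
  by exists RSucc.
have := computable_comp cS (F := fun _ => F) (fun=> cF).
by congr computable; apply: funext => v; rewrite /thead tnth_mktuple.
Qed.

Lemma computable_const n c : computable (fun _ : n.-tuple nat => c).
Proof. by elim: c => [|c]; [exists (RZero n) | exact: computable_succ]. Qed.

Lemma computable_comp2 n (H : nat -> nat -> nat) (F G : n.-tuple nat -> nat) :
  computable (fun v : 2.-tuple nat => H (nth 0 v 0) (nth 0 v 1)) ->
  computable F -> computable G -> computable (fun v => H (F v) (G v)).
Proof.
move=> cH cF cG.
have cFG (i : 'I_2) : computable (if i == 0 :> nat then F else G) by case: ifP.
have := computable_comp cH cFG; congr computable; apply: funext => v.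
by rewrite -!(tnth_nth 0 _ ord0) -!(tnth_nth 0 _ (lift ord0 ord0)) !tnth_mktuple.
Qed.

Lemma computable_add n (F G : n.-tuple nat -> nat) :
  computable F -> computable G -> computable (fun v => F v + G v).
Proof.
apply: computable_comp2.
apply: (@computable_rec 1 (fun v => nth 0 v 0) (fun v => (nth 0 v 1).+1)) => //.
- exact: computable_nth.
- exact/computable_succ/computable_nth.
Qed.

Lemma computable_mul n (F G : n.-tuple nat -> nat) :
  computable F -> computable G -> computable (fun v => F v * G v).
Proof.
apply: computable_comp2.
apply: (@computable_rec 1 (fun=> 0) (fun v => nth 0 v 2 + nth 0 v 1)) => //.
- exact: computable_const.
- by apply: computable_add; exact: computable_nth.
Qed.

(** [code (a :: s)] is [2 ^ a * (2 * code s + 1)], so recursion on [a] starts at [2 * code s + 1]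
    and doubles at every step. *)
Lemma computable_code_cons n (F : n.-tuple nat -> nat) (S : n.-tuple nat -> seq nat) :
  computable F -> computable (fun v => CodeSeq.code (S v)) ->
  computable (fun v => CodeSeq.code (F v :: S v)).
Proof.
apply: (@computable_comp2 _ (fun a s => 2 ^ a * s.*2.+1)).
apply: (@computable_rec 1 (fun v => (nth 0 v 0 + nth 0 v 0).+1)
  (fun v => nth 0 v 1 + nth 0 v 1)).
- exact/computable_succ/computable_add/computable_nth/computable_nth.
- exact/computable_add/computable_nth/computable_nth.
- by move=> v /=; rewrite mul1n addnn.
- by move=> k v /=; rewrite addnn expnS -mulnA mul2n.
Qed.

(** * Compiling recursive functions to counter programs *)

Definition store := nat -> nat.

Definition upd (s : store) (r x : nat) : store :=
  fun r' => if r' == r then x else s r'.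

Inductive cmd :=
| Skip
| Incr of nat
| Seq of cmd & cmd
| Loop of nat & cmd.

(* [Loop r c] decrements r before each execution of c. *)
Inductive exec : cmd -> store -> store -> Prop :=
| ESkip s : exec Skip s s
| EIncr r s : exec (Incr r) s (upd s r (s r).+1)
| ESeq c1 c2 s1 s2 s3 :
    exec c1 s1 s2 -> exec c2 s2 s3 -> exec (Seq c1 c2) s1 s3
| ELoop0 r c s : s r = 0 -> exec (Loop r c) s s
| ELoopS r c s1 s2 s3 : 0 < s1 r -> exec c (upd s1 r (s1 r).-1) s2 ->
    exec (Loop r c) s2 s3 -> exec (Loop r c) s1 s3.

Lemma exec_loop r c m (S : nat -> store) :
  (forall j, j < m ->
     0 < S j r /\ exec c (upd (S j) r (S j r).-1) (S j.+1)) ->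
  S m r = 0 -> exec (Loop r c) (S 0) (S m).
Proof.
elim: m S => [|m IH] S HS Sm; first exact: ELoop0.
have [S0 E0] := HS 0 isT; apply: ELoopS S0 E0 _.
by apply: (IH (fun j => S j.+1)) => // j jm; apply: HS.
Qed.

Lemma exec_eq c s s1 s2 : exec c s s1 -> s1 =1 s2 -> exec c s s2.
Proof. by move=> E /funext <-. Qed.

Ltac upds := rewrite /upd; repeat (case: eqP => [?|?]; subst => //=); try lia.

Definition clear r := Loop r Skip.

Lemma exec_clear r s : exec (clear r) s (upd s r 0).
Proof.
pose S j := upd s r (s r - j).
have : exec (clear r) (S 0) (S (s r)).
  apply: exec_loop => [j js|]; last by rewrite /S; upds.
  split; first by rewrite /S; upds.
  by apply: exec_eq (ESkip _) _ => x; rewrite /S; upds.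
by congr exec; apply: funext => x; rewrite /S; upds.
Qed.

Definition move r o := Loop r (Incr o).

Lemma exec_move r o s : r != o ->
  exec (move r o) s (upd (upd s o (s o + s r)) r 0).
Proof.
move=> /eqP ro; pose S j := upd (upd s o (s o + j)) r (s r - j).
have : exec (move r o) (S 0) (S (s r)).
  apply: exec_loop => [j js|]; last by rewrite /S; upds.
  split; first by rewrite /S; upds.
  by apply: exec_eq (EIncr _ _) _ => x; rewrite /S; upds.
by congr exec; apply: funext => x; rewrite /S; upds.
Qed.

(** Loops consume their counter, so [t] keeps a second copy of [r] that is moved back afterwards.
    The value is added to [o]. *)
Definition copy r o t := Seq (Loop r (Seq (Incr o) (Incr t))) (move t r).

Lemma exec_copy r o t s : r != o -> r != t -> o != t -> s t = 0 ->
  exec (copy r o t) s (upd s o (s o + s r)).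
Proof.
move=> /eqP ro rt /eqP ot st0; have /eqP rt' := rt.
pose S j := upd (upd (upd s o (s o + j)) t j) r (s r - j).
have E : exec (Loop r (Seq (Incr o) (Incr t))) (S 0) (S (s r)).
  apply: exec_loop => [j js|]; last by rewrite /S; upds.
  split; first by rewrite /S; upds.
  apply: exec_eq (ESeq (EIncr _ _) (EIncr _ _)) _ => x; rewrite /S; upds.
have <- : S 0 = s by apply: funext => x; rewrite /S; upds.
apply: ESeq E _; apply: exec_eq (exec_move _ _) _; first by rewrite eq_sym.
by move=> x; rewrite /S; upds.
Qed.

Fixpoint clear_range b m :=
  if m is m'.+1 then Seq (clear b) (clear_range b.+1 m') else Skip.

Lemma exec_clear_range b m s :
  exec (clear_range b m) s (fun r => if b <= r < b + m then 0 else s r).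
Proof.
elim: m b s => [|m IH] b s /=.
  by apply: exec_eq (ESkip _) _ => x; rewrite addn0; case: ifP => //; lia.
apply: exec_eq (ESeq (exec_clear _ _) (IH _ _)) _ => x.
by rewrite /upd; do ![case: ifP] => //; lia.
Qed.

(* [a i] is the register of the i-th argument and [o] receives the result;
   registers from [b] on are scratch, zero before and after. *)
Fixpoint compile n (f : recf n) (a : nat -> nat) (o b : nat) : cmd :=
  match f with
  | RZero _ => Skip
  | RSucc => Seq (copy (a 0) o b) (Incr o)
  | RProj _ i => copy (a i) o b
  | RComp m _ f g =>
      Seq (foldr (fun i => Seq (compile (g i) a (b + i) (b + m))) Skip (enum 'I_m))
      (Seq (compile f (addn b) o (b + m)) (clear_range b m))
  | RPrec _ f g =>
      let args i := match i with 0 => b | 1 => b.+1 | i'.+2 => a i'.+1 end in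
      Seq (compile f (fun i => a i.+1) b.+1 (b + 4))
      (Seq (copy (a 0) b.+2 b.+3)
      (Seq (Loop b.+2 (Seq (compile g args b.+3 (b + 4))
                      (Seq (clear b.+1) (Seq (move b.+3 b.+1) (Incr b)))))
      (Seq (move b.+1 o) (clear b))))
  | RMu _ f =>
      let args i := if i is i'.+1 then a i' else b in
      Seq (Incr b.+2)
      (Seq (Loop b.+2 (Seq (compile f args b.+1 (b + 3))
                      (Loop b.+1 (Seq (clear b.+1) (Seq (Incr b.+2) (Incr b))))))
      (move b o))
  end.

(** Only the existence of an execution with the right result is claimed; that the machine has no
    other outcome comes later from determinism. The output register starts at 0 because results are
    added to it. *)
Lemma compileP n (f : recf n) v y (a : nat -> nat) o b (s : store) : eval f v y ->
  (forall i : 'I_n, a i < b /\ a i <> o) -> o < b -> s o = 0 ->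
  (forall r, b <= r -> s r = 0) -> (forall i : 'I_n, s (a i) = tnth v i) ->
  exec (compile f a o b) s (upd s o y).
Proof.
elim: f v y a o b s => {n} [n||n i|m n f IHf g IHg|n f IHf g IHg|n f IHf]
  v y a o b s ev aP ob so sb sa.
- move: ev => /= ->; apply: exec_eq (ESkip _) _ => x; upds.
- have /= [ab /eqP ao] := aP ord0; move: ev => /= ->.
  have cp : exec (copy (a 0) o b) s (upd s o (s o + s (a 0))).
    by apply: exec_copy => //; try lia; apply: sb.
  apply: exec_eq (ESeq cp (EIncr _ _)) _ => x.
  by have /= -> := sa ord0; rewrite so; upds.
- have [ab /eqP ao] := aP i; move: ev => /= ->.
  have cp : exec (copy (a i) o b) s (upd s o (s o + s (a i))).
    by apply: exec_copy => //; try lia; apply: sb.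
  by apply: exec_eq cp _ => x; rewrite sa so; upds.
- move: ev => /= [w [gw fw]].
  pose val_at (l : seq 'I_m) r := r \in [seq b + val i | i <- l].
  (* Generalised from [enum 'I_m] to duplicate-free lists, so that the components are evaluated one
     at a time into the registers [b + i]. *)
  have args (l : seq 'I_m) (s' : store) : uniq l ->
      (forall i : 'I_m, i \in l -> s' (b + i) = 0) ->
      (forall r, b + m <= r -> s' r = 0) -> (forall i : 'I_n, s' (a i) = tnth v i) ->
      exec (foldr (fun i => Seq (compile (g i) a (b + i) (b + m))) Skip l) s'
        (fun r => if val_at l r then nth 0 w (r - b) else s' r).
    elim: l s' => [|i l IHl] s' /=.
      by move=> *; apply: exec_eq (ESkip _) _.
    move=> /andP[il ul] s'0 s'b s'a.
    have E : exec (compile (g i) a (b + i) (b + m)) s' (upd s' (b + i) (tnth w i)).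
      apply: (IHg _ v) => //.
      - by move=> j; have [] := aP j; lia.
      - by have := ltn_ord i; lia.
      - by apply: s'0; rewrite mem_head.
    apply: exec_eq (ESeq E (IHl _ ul _ _ _)) _ => [j jl|r rb|j|r].
    + rewrite /upd eqn_add2l; case: eqP => [/val_inj ji|_].
        by rewrite -ji jl in il.
      by apply: s'0; rewrite inE jl orbT.
    + by rewrite /upd; case: eqP => [|_]; [have := ltn_ord i; lia|exact: s'b].
    + by rewrite /upd s'a; case: eqP => // ?; have [? _] := aP j; exfalso; lia.
    + rewrite /val_at /= inE /upd; case: (r \in map _ l); first by rewrite orbT.
      by rewrite orbF; case: eqP => // ->; rewrite addKn (tnth_nth 0).
  have val_atE r : val_at (enum 'I_m) r = (b <= r < b + m).
    apply/mapP/idP => [[i _ ->]|rb]; first by rewrite /=; have := ltn_ord i; lia.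
    have rm : r - b < m by lia.
    by exists (Ordinal rm); rewrite ?mem_enum //=; lia.
  set s1 := fun r => if b <= r < b + m then nth 0 w (r - b) else s r.
  have E1 : exec (foldr (fun i => Seq (compile (g i) a (b + i) (b + m))) Skip
      (enum 'I_m)) s s1.
    apply: exec_eq (args _ _ (enum_uniq _) _ _ _) _ => //.
    - by move=> i _; apply: sb; lia.
    - by move=> r rb; apply: sb; lia.
    - by move=> r; rewrite val_atE.
  have E2 : exec (compile f (addn b) o (b + m)) s1 (upd s1 o y).
    apply: (IHf w) => //.
    - by move=> i; have := ltn_ord i; lia.
    - by lia.
    - by rewrite /s1; case: ifP => //; lia.
    - by move=> r rb; rewrite /s1 sb; [case: ifP => //; lia|lia].
    - move=> i; rewrite /s1 addKn (tnth_nth 0).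
      by case: ifP => //; have := ltn_ord i; lia.
  apply: exec_eq (ESeq E1 (ESeq E2 (exec_clear_range _ _ _))) _ => r.
  rewrite /upd /s1; do ![case: ifP] => //; try lia.
  by move=> *; rewrite sb //; lia.
- move: ev => /= [u [u0 uS ->]].
  have a0 : a 0 < b /\ a 0 <> o := aP ord0.
  have aS (i : 'I_n) : a i.+1 < b /\ a i.+1 <> o := aP (lift ord0 i).
  have sa0 : s (a 0) = thead v := sa ord0.
  have saS (i : 'I_n) : s (a i.+1) = _ := sa (lift ord0 i).
  have saS' (i : 'I_n) : s (a i.+1) = tnth (behead_tuple v) i.
    by rewrite saS !(tnth_nth 0) /= nth_behead.
  set A := thead v in sa0 *.
  (* Store after [j] rounds: [b] holds the recursion index, [b.+1] the current value, [b.+2] the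
     number of rounds left. Within a round [b.+3] receives the next value. *)
  pose S j := upd (upd (upd s b j) b.+1 (u j)) b.+2 (A - j).
  have E1 : exec (compile f (fun i => a i.+1) b.+1 (b + 4)) s (upd s b.+1 (u 0)).
    apply: (IHf _ _ _ _ _ _ u0) => //.
    - by move=> i; have := aS i; lia.
    - by lia.
    - by apply: sb; lia.
    - by move=> r rb; apply: sb; lia.
  have E2 : exec (copy (a 0) b.+2 b.+3) (upd s b.+1 (u 0)) (S 0).
    have cp : exec (copy (a 0) b.+2 b.+3) (upd s b.+1 (u 0))
       (upd (upd s b.+1 (u 0)) b.+2
          (upd s b.+1 (u 0) b.+2 + upd s b.+1 (u 0) (a 0))).
      by apply: exec_copy; try lia; rewrite /upd; case: eqP => [|_]; [lia|apply: sb; lia].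
    apply: exec_eq cp _ => r; rewrite /S; upds; rewrite ?sa0 ?sb //; lia.
  have E3 : exec (Loop b.+2 (Seq (compile g
      (fun i => match i with 0 => b | 1 => b.+1 | i'.+2 => a i'.+1 end) b.+3 (b + 4))
      (Seq (clear b.+1) (Seq (move b.+3 b.+1) (Incr b))))) (S 0) (S A).
    apply: exec_loop => [j jA|]; last by rewrite /S; upds.
    split; first by rewrite /S; upds.
    set s3 := upd _ _ _.
    have G : exec (compile g (fun i => match i with 0 => b | 1 => b.+1
        | i'.+2 => a i'.+1 end) b.+3 (b + 4)) s3 (upd s3 b.+3 (u j.+1)).
      apply: (IHg _ _ _ _ _ _ (uS j jA)).
      - move=> [[|[|i]] ?] /=; try lia.
        have lt_in : i < n by lia.
        by have /= := aS (Ordinal lt_in); lia.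
      - by lia.
      - by rewrite /s3 /S; upds; apply: sb; lia.
      - by move=> r rb; rewrite /s3 /S; upds; apply: sb; lia.
      - move=> [[|[|i]] lti] /=; rewrite (tnth_nth 0) /=.
        + by rewrite /s3 /S; upds.
        + by rewrite /s3 /S; upds.
        + have lt_in : i < n by lia.
          have /= ai := aS (Ordinal lt_in).
          have /= := saS' (Ordinal lt_in); rewrite (tnth_nth 0) /= => <-.
          by rewrite /s3 /S; upds.
    apply: exec_eq (ESeq G (ESeq (exec_clear _ _)
      (ESeq (exec_move _ _) (EIncr _ _)))) _; first by lia.
    move=> r; rewrite /s3 /S; upds; apply/esym/sb; lia.
  apply: exec_eq (ESeq E1 (ESeq E2 (ESeq E3 (ESeq (exec_move _ _)
     (exec_clear _ _))))) _; first by lia.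
  move=> r; rewrite /S; upds; apply/esym; rewrite ?sb //; lia.
- move: ev => /= [ey en].
  (* Register [b.+2] is a flag which is 1 while the search goes on. The round with candidate [y]
     finds the value 0 and does not increment [b], hence [minn]. The inner loop runs at most once,
     since its body clears its own counter [b.+1]. *)
  pose S j := upd (upd s b (minn j y)) b.+2 (j <= y : nat).
  set args := fun i => _.
  have F j z : j <= y -> eval f [tuple of j :: v] z ->
      exec (compile f args b.+1 (b + 3)) (upd (S j) b.+2 0) (upd (upd s b j) b.+1 z).
    move=> jy ez; have -> : upd (S j) b.+2 0 = upd s b j.
      by apply: funext => r; rewrite /S; upds; apply/esym/sb; lia.
    apply: (IHf _ _ _ _ _ _ ez).
    - move=> [[|i] ?] /=; try lia.
      have lt_in : i < n by lia.
      by have /= := aP (Ordinal lt_in); lia.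
    - by lia.
    - by upds; apply: sb; lia.
    - by move=> r rb; upds; apply: sb; lia.
    - move=> [[|i] lti]; rewrite (tnth_nth 0) /=; first by upds.
      have lt_in : i < n by lia.
      have /= := aP (Ordinal lt_in) => ai.
      have /= := sa (Ordinal lt_in); rewrite (tnth_nth 0) /= => <-.
      by upds.
  have E2 : exec (Loop b.+2 (Seq (compile f args b.+1 (b + 3))
      (Loop b.+1 (Seq (clear b.+1) (Seq (Incr b.+2) (Incr b)))))) (S 0) (S y.+1).
    apply: exec_loop => [j jy|]; last by rewrite /S /upd eqxx ltnn.
    rewrite ltnS in jy.
    have Sj : S j b.+2 = 1 by rewrite /S /upd eqxx jy.
    rewrite Sj; split=> //=; have [->|jy'] := eqVneq j y.
      apply: exec_eq (ESeq (F _ _ (leqnn y) ey) (ELoop0 _ _)) _; first by upds.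
      by move=> r; rewrite /S ltnn; upds; rewrite ?sb //; lia.
    have {jy'}jy' : j < y by lia.
    have [z ez] := en j jy'.
    have body : exec (Seq (clear b.+1) (Seq (Incr b.+2) (Incr b)))
        (upd (upd (upd s b j) b.+1 z.+1) b.+1
          (upd (upd s b j) b.+1 z.+1 b.+1).-1) (S j.+1).
      apply: exec_eq (ESeq (exec_clear _ _) (ESeq (EIncr _ _) (EIncr _ _))) _.
      move=> r; rewrite /S (_ : j.+1 <= y) //; upds; rewrite ?sb //; lia.
    apply: ESeq (F _ _ jy ez) (ELoopS _ body (ELoop0 _ _)); first by upds.
    by rewrite /S; upds; apply: sb; lia.
  apply: exec_eq (ESeq (EIncr _ _) (ESeq _ (exec_move _ _))) _.
  - have -> : upd s b.+2 (s b.+2).+1 = S 0.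
      by apply: funext => r; rewrite /S; upds; rewrite ?sb //; lia.
    exact: E2.
  - lia.
  - by move=> r; rewrite /S ltnn; upds; rewrite ?sb //; lia.
Qed.

(** * Counter machines *)

Inductive op := OInc of nat | ODec of nat | OZero of nat | ONop.

Record instr := Instr { src : nat; act : op; dst : nat }.

Definition enabled (o : op) (s : store) : Prop :=
  match o with ODec r => 0 < s r | OZero r => s r = 0 | _ => True end.

Definition apply_op (o : op) (s : store) : store :=
  match o with
  | OInc r => upd s r (s r).+1
  | ODec r => upd s r (s r).-1
  | _ => s
  end.

Definition config := (nat * store)%type.

Inductive reach (L : seq instr) : config -> config -> Prop :=
| ReachRefl c : reach L c c
| ReachStep t s c : List.In t L -> enabled (act t) s ->
    reach L (dst t, apply_op (act t) s) c -> reach L (src t, s) c.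

Lemma reach_trans L c1 c2 c3 : reach L c1 c2 -> reach L c2 c3 -> reach L c1 c3.
Proof.
by elim=> [//|t s c tL en _ IH] /IH; exact: ReachStep tL en.
Qed.

Lemma reach1 L p o q s s' : List.In (Instr p o q) L -> enabled o s ->
  apply_op o s = s' -> reach L (p, s) (q, s').
Proof. by move=> tL en <-; apply: (ReachStep tL en); exact: ReachRefl. Qed.

Fixpoint csize (c : cmd) : nat :=
  match c with
  | Skip => 0
  | Incr _ => 1
  | Seq c1 c2 => csize c1 + csize c2
  | Loop _ c => (csize c).+2
  end.

(** The code of [c] occupies the program counters from [b] up to, but excluding, [b + csize c],
    which is its exit. *)
Fixpoint flatten_cmd (b : nat) (c : cmd) : seq instr :=
  match c with
  | Skip => [::]
  | Incr r => [:: Instr b (OInc r) b.+1]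
  | Seq c1 c2 => flatten_cmd b c1 ++ flatten_cmd (b + csize c1) c2
  | Loop r c => [:: Instr b (ODec r) b.+1; Instr b (OZero r) (b + (csize c).+2);
                    Instr (b.+1 + csize c) ONop b] ++ flatten_cmd b.+1 c
  end.

Lemma reach_exec L c s s' b : exec c s s' ->
  (forall t, List.In t (flatten_cmd b c) -> List.In t L) ->
  reach L (b, s) (b + csize c, s').
Proof.
move=> E; elim: E b => {c s s'} [s|r s|c1 c2 s1 s2 s3 _ IH1 _ IH2|r c s sr
  |r c s1 s2 s3 sr _ IH1 _ IH2] b sub /=.
- by rewrite addn0; exact: ReachRefl.
- by rewrite addn1; apply: (@reach1 _ _ (OInc r)) => //; apply: sub; left.
- rewrite addnA; apply: (reach_trans (IH1 b _) (IH2 (b + csize c1) _)) => t tc;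
    apply: sub => /=; apply/List.in_app_iff; by [left|right].
- by apply: (@reach1 _ _ (OZero r)) => //; apply: sub; right; left.
- apply: reach_trans (IH2 b sub).
  apply: (reach_trans (c2 := (b.+1, upd s1 r (s1 r).-1))).
    by apply: (@reach1 _ _ (ODec r)) => //; apply: sub; left.
  apply: (reach_trans (IH1 b.+1 _)) => [t tc|]; first by apply: sub; do 3!right.
  by apply: (@reach1 _ _ ONop) => //; apply: sub; do 2!right; left.
Qed.

Definition deterministic (L : seq instr) := forall t t' s,
  List.In t L -> List.In t' L -> src t = src t' ->
  enabled (act t) s -> enabled (act t') s -> t = t'.

Lemma flatten_src b c t : List.In t (flatten_cmd b c) -> b <= src t < b + csize c.
Proof.
elim: c b => [|r|c1 IH1 c2 IH2|r c IH] b //=.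
- by case=> // <- /=; lia.
- by move/List.in_app_iff => [/IH1|/IH2]; lia.
- by case=> [<-|[<-|[<-|/IH]]] /=; lia.
Qed.

Lemma flatten_dst b c t : List.In t (flatten_cmd b c) -> b <= dst t.
Proof.
elim: c b => [|r|c1 IH1 c2 IH2|r c IH] b //=.
- by case=> // <- /=; lia.
- by move/List.in_app_iff => [/IH1|/IH2]; lia.
- by case=> [<-|[<-|[<-|/IH]]] /=; lia.
Qed.

(** Subcommands occupy disjoint ranges of program counters, and the two instructions at the head of
    a loop have complementary tests. *)
Lemma deterministic_flatten b c : deterministic (flatten_cmd b c).
Proof.
elim: c b => [|r|c1 IH1 c2 IH2|r c IH] b t t' s //=.
- by move=> [<-|[]] [<-|[]].
- move=> /List.in_app_iff[T|T] /List.in_app_iff[T'|T'] e.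
  + exact: (IH1 _ _ _ s T T' e).
  + by have := flatten_src T; have := flatten_src T'; lia.
  + by have := flatten_src T; have := flatten_src T'; lia.
  + exact: (IH2 _ _ _ s T T' e).
- case=> [<-|[<-|[<-|T]]] [<-|[<-|[<-|T']]] //=; try lia.
  + by have := flatten_src T'; lia.
  + by have := flatten_src T'; lia.
  + by have := flatten_src T'; lia.
  + by have := flatten_src T; lia.
  + by have := flatten_src T; lia.
  + by have := flatten_src T; lia.
  + by move=> e; exact: (IH _ _ _ s T T' e).
Qed.

Lemma reachE L p s c : reach L (p, s) c -> (p, s) = c \/
  exists t, [/\ List.In t L, src t = p, enabled (act t) s &
                reach L (dst t, apply_op (act t) s) c].
Proof.
move E: (p, s) => ps R; case: R E => [c'|t s' c' tL en r]; first by left.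
by case=> -> ->; right; exists t.
Qed.

(** Of two computations from the same configuration one extends the other, and the one that ends in
    a stuck configuration cannot be the shorter. *)
Lemma deterministic_reach L c x y : deterministic L ->
  reach L c x -> reach L c y ->
  (forall t, List.In t L -> src t = x.1 -> ~ enabled (act t) x.2) ->
  reach L y x.
Proof.
move=> det cx; elim: cx y => {c x} [[p s]|t s c tL en cx IH] y.
  case/reachE=> [-> _|[t [tL tp en _]] stuck]; first exact: ReachRefl.
  by case: (stuck t tL).
case/reachE=> [<- _|[t' [t'L tt' en' cy]] stuck]; first exact: ReachStep cx.
by apply: IH stuck; rewrite (det t t' s).
Qed.

Lemma reach_invariant L (P : nat -> Prop) c c' :
  (forall t, List.In t L -> P (src t) -> P (dst t)) ->
  reach L c c' -> P c.1 -> P c'.1.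
Proof.
by move=> inv; elim=> [//|t s c'' tL _ _ IH] /= Pt; apply: IH; exact: inv.
Qed.

Local Open Scope ring_scope.

(** * Runs of priced timed automata as sequences *)

(* WMTL on positions of a run of length N: the position j carries the labels
   [lab j] and is reached with accumulated cost [C j]. *)
Fixpoint tsat (R : realType) (N : nat) (lab : nat -> seq nat) (C : nat -> R)
    (j : nat) (phi : wmtl) : Prop :=
  match phi with
  | WAtom a => a \in lab j
  | WNot p => ~ tsat N lab C j p
  | WOr p1 p2 => tsat N lab C j p1 \/ tsat N lab C j p2
  | WUntil p1 o c p2 =>
      exists k, [/\ (j < k <= N)%N, tsat N lab C k p2,
        forall i, (j < i < k)%N -> tsat N lab C i p1
      & cmp_holds o (C k - C j) c]
  end.

Lemma tsat_eq (R : realType) N lab lab' (C C' : nat -> R) j phi :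
  (forall i, (i <= N)%N -> lab i = lab' i) ->
  (forall i, (i <= N)%N -> C i = C' i) -> (j <= N)%N ->
  tsat N lab C j phi <-> tsat N lab' C' j phi.
Proof.
move=> El EC; elim: phi j => [a|p IH|p IHp q IHq|p IHp o c q IHq] j jN /=.
- by rewrite El.
- by rewrite IH.
- by rewrite IHp // IHq.
- split=> -[k [/andP[jk kN] Hq Hp Hc]]; exists k; rewrite jk kN.
    split=> //; first by apply/IHq.
      by move=> i /andP[ji ik]; apply/IHp; [lia|apply: Hp; lia].
    by rewrite -!EC.
  split=> //; first by apply/IHq.
    by move=> i /andP[ji ik]; apply/IHp; [lia|apply: Hp; lia].
  by rewrite !EC.
Qed.

Section Runs.
Variables (R : realType) (A : pta).
Implicit Type r : run R A.

Definition state_at r j : state R A := start (run_suffix r j).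

Lemma last_take (T : Type) (x : T) s j : (j <= size s)%N ->
  last x (take j s) = nth x (x :: s) j.
Proof.
elim: s x j => [|y s IH] x [|j] //= js; rewrite IH //.
by case: j js => //= j js; apply: set_nth_default.
Qed.

Lemma state_atE r j : (j <= size (steps r))%N ->
  state_at r j = nth (start r) (start r :: unzip2 (steps r)) j.
Proof. by move=> js; rewrite /state_at /= /unzip2 map_take last_take ?size_map. Qed.

Lemma steps_cost_cat (s : state R A) (w1 w2 : seq (step R A)) :
  steps_cost s (w1 ++ w2) =
  steps_cost s w1 + steps_cost (last s (unzip2 w1)) w2.
Proof.
elim: w1 s => [|[[t e] s'] w1 IH] s /=; first by rewrite add0r.
by rewrite IH addrA.
Qed.

Lemma suffix_suffix r j k : run_suffix (run_suffix r j) k = run_suffix r (j + k).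
Proof.
by rewrite /run_suffix /= takeD /unzip2 map_cat last_cat drop_drop addnC.
Qed.

Lemma cost_prefix_suffix r j k :
  run_cost (run_prefix (run_suffix r j) k) =
  run_cost (run_prefix r (j + k)) - run_cost (run_prefix r j).
Proof. by rewrite /run_cost /= takeD steps_cost_cat addrAC subrr add0r. Qed.

(** A suffix of a suffix is a suffix of [r], and the cost between two positions is a difference of
    prefix costs; so satisfaction depends only on a position in one fixed run. *)
Lemma wsat_suffix r j phi : (j <= run_length r)%N ->
  wsat (run_suffix r j) phi <->
  tsat (run_length r) (fun j => label A (state_at r j).1)
    (fun j => run_cost (run_prefix r j)) j phi.
Proof.
elim: phi j => [a|p IH|p IHp q IHq|p IHp o c q IHq] j jN //.
- by rewrite /= IH.
- by rewrite /= IHp // IHq.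
rewrite [wsat _ _]/= [tsat _ _ _ _ _]/=.
have -> : run_length (run_suffix r j) = (run_length r - j)%N.
  by rewrite /run_length /= size_drop.
split=> -[k [kN Hq Hp Hc]].
- exists (j + k)%N; split; first by lia.
  + by apply/IHq; [lia|rewrite -suffix_suffix].
  + move=> i ji; apply/IHp; first by lia.
    by rewrite -(subnKC (_ : (j <= i)%N)) -?suffix_suffix; [apply: Hp|]; lia.
  + by rewrite -cost_prefix_suffix.
- exists (k - j)%N; rewrite suffix_suffix cost_prefix_suffix subnKC; last by lia.
  split; [lia| |move=> i ij|] => //; first by apply/IHq; [lia|].
  by rewrite suffix_suffix; apply/IHp; [lia|apply: Hp; lia].
Qed.

Lemma valid_steps_nth (s : state R A) (w : seq (step R A)) x0 :
  valid_steps s w <->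
  forall j, (j < size w)%N ->
    mixed_move (nth s (s :: unzip2 w) j) (nth x0 w j).1.1 (nth x0 w j).1.2
      (nth x0 w j).2.
Proof.
elim: w s => [|[[t e] s'] w IH] s //=.
have nthE j : (j < size w)%N ->
    nth s (s' :: unzip2 w) j = nth s' (s' :: unzip2 w) j.
  by move=> jw; apply: set_nth_default; rewrite /= size_map ltnW.
split=> [[mv /IH vw] [|j] //= jw|H]; first by rewrite nthE //; exact: vw.
split; first exact: (H 0%N).
by apply/IH => j jw; rewrite -nthE //; exact: (H j.+1).
Qed.

Lemma run_costS r x0 j : (j < size (steps r))%N ->
  run_cost (run_prefix r j.+1) = run_cost (run_prefix r j) +
    ((nth x0 (steps r) j).1.1 * (rate A (state_at r j).1)%:R
     + (edge_cost (nth x0 (steps r) j).1.2)%:R).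
Proof.
move=> js; rewrite /run_cost /= (take_nth x0) // -cats1 steps_cost_cat /=.
by case: (nth x0 _ _) => [[t e] s'] /=; rewrite addr0.
Qed.

End Runs.

(** * Automata with trivial invariants and free transitions *)

Section MkPta.
Variables (Q : finType) (q0 : Q) (ed : Q -> Q -> option (constraint * bool)).
Variables (rt : Q -> nat) (lb : Q -> seq nat).

Definition mk_edges : seq (edge #|Q|) :=
  undup (pmap (fun x : Q * Q =>
    omap (fun gr => (enum_rank x.1, gr.1, gr.2, enum_rank x.2)) (ed x.1 x.2))
    (enum {: Q * Q})).

Lemma mk_edges_uniq : uniq (unzip1 [seq (e, 0%N) | e <- mk_edges]).
Proof. by rewrite /unzip1 -map_comp map_id undup_uniq. Qed.

(** The invariants hold for every clock value that occurs and transitions cost 0, so a run amounts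
    to its locations, clock values and delays, as recorded in [tpath]. *)
Definition mk_pta : pta :=
  @PTA #|Q| (enum_rank q0) [ffun=> CAtom CGe 0]
    [ffun i => rt (enum_val i)] [ffun i => lb (enum_val i)]
    [seq (e, 0%N) | e <- mk_edges] mk_edges_uniq.

Lemma mk_pta_edges q g b q' : ((q, g, b, q') \in edges mk_pta) =
  (ed (enum_val q) (enum_val q') == Some (g, b)).
Proof.
rewrite /edges /unzip1 -map_comp map_id mem_undup mem_pmap.
apply/mapP/eqP => [[[p p'] _ /=]|E].
  by case E: (ed p p') => [[g' b']|] //= [-> -> -> ->]; rewrite !enum_rankK E.
exists (enum_val q, enum_val q'); first by rewrite mem_enum.
by rewrite /= E /= !enum_valK.
Qed.

Lemma mk_pta_cost e : @edge_cost mk_pta e = 0%N.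
Proof.
rewrite /edge_cost /unzip2 -map_comp.
set s := map _ _; have -> : s = nseq (size s) 0%N.
  by apply/all_pred1P/allP => x /mapP[? _ ->] /=.
by rewrite nth_nseq if_same.
Qed.

Variable R : realType.

Definition tpath (N : nat) (q : nat -> Q) (v d : nat -> R) : Prop :=
  [/\ q 0%N = q0, v 0%N = 0 & forall j, (j < N)%N -> 0 <= d j /\
    exists g b, [/\ ed (q j) (q j.+1) = Some (g, b), csat (v j + d j) g
                  & v j.+1 = if b then 0 else v j + d j]].

Definition tcost (q : nat -> Q) (d : nat -> R) (k : nat) : R :=
  \sum_(i < k) d i * (rt (q i))%:R.

Lemma tcostS q d k : tcost q d k.+1 = tcost q d k + d k * (rt (q k))%:R.
Proof. by rewrite /tcost big_ord_recr. Qed.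

Lemma tpath_ge0 N q v d j : tpath N q v d -> (j <= N)%N -> 0 <= v j.
Proof.
case=> _ v0 st; elim: j => [|j IH] jN; first by rewrite v0.
have [dj [g [b [_ _ ->]]]] := st j jN.
by case: b => //; rewrite addr_ge0 // IH // ltnW.
Qed.

Lemma realizable_mk_pta phi : @wmtl_realizable R (mk_pta, phi) <->
  exists N q v d, tpath N q v d /\
    tsat N (fun j => lb (q j)) (tcost q d) 0 phi.
Proof.
split.
- case=> r [/= r0 vr sat].
  (* A default element for [nth]. *)
  pose x0 : step R mk_pta := (0, (init mk_pta, CAtom CGe 0, true, init mk_pta), start r).
  pose q j := enum_val (state_at r j).1; pose v j := (state_at r j).2.
  pose d j := (nth x0 (steps r) j).1.1.
  have mv j : (j < size (steps r))%N ->
      mixed_move (state_at r j) (d j) (nth x0 (steps r) j).1.2 (state_at r j.+1).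
    move=> js; move/valid_steps_nth: vr => /(_ x0 j js).
    rewrite -/(d j) !state_atE //; last by rewrite ltnW.
    by rewrite /= (nth_map x0).
  exists (run_length r), q, v, d; split; first split.
  + by rewrite /q state_atE //= r0 /= enum_rankK.
  + by rewrite /v state_atE //= r0.
  + move=> j js; case: (mv j js) => s1 [dj _ ->].
    case: (nth x0 _ _).1.2 => [[[p g] b] p'] [/= eE pE sg E _]; subst p; split=> //.
    exists g, b; rewrite /q /v E /=; split=> //.
    by move: eE; rewrite mk_pta_edges => /eqP.
  + have {}sat : wsat (run_suffix r 0) phi.
      by rewrite /run_suffix take0 drop0 /=; case: (r) sat.
    move/wsat_suffix: sat => /(_ isT); apply: (proj1 (tsat_eq _ _ _ _)) => //.
    * by move=> i _; rewrite ffunE.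
    * elim=> [|j IH] js; first by rewrite /tcost big_ord0 /run_cost /= take0.
      by rewrite (run_costS x0) // mk_pta_cost addr0 IH ?(ltnW js) // tcostS ffunE.
- case=> N [q [v [d [pth sat]]]]; have [q_0 v0 st] := pth.
  (* The path only asserts that suitable edges exist; they are chosen for all positions at once,
     with an arbitrary edge from [N] on. *)
  have /choice[e eP] : forall j, exists e, (j < N)%N ->
      mixed_move (A := mk_pta) (enum_rank (q j), v j) (d j) e
        (enum_rank (q j.+1), v j.+1).
    move=> j.
    case: (ltnP j N) => [jN|_]; last first.
      by exists (enum_rank q0, CAtom CGe 0, true, enum_rank q0).
    have [dj [g [b [E sg vE]]]] := st j jN.
    have vj := tpath_ge0 pth (ltnW jN).
    exists (enum_rank (q j), g, b, enum_rank (q j.+1)) => _.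
    exists (enum_rank (q j), v j + d j).
      split=> //= u /andP[u0 _]; rewrite ffunE /= addr_ge0 //.
    split=> //=; rewrite ?mk_pta_edges ?enum_rankK ?E ?vE // ffunE /=.
    by case: b {E vE} => //; rewrite addr_ge0.
  pose w : seq (step R mk_pta) :=
    mkseq (fun j => (d j, e j, (enum_rank (q j.+1), v j.+1))) N.
  pose r : run R mk_pta := @Run R mk_pta (enum_rank (q 0%N), v 0%N) w.
  have x0 : step R mk_pta := (0, (init mk_pta, CAtom CGe 0, true, init mk_pta), start r).
  have szw : size w = N by rewrite size_mkseq.
  have stE j : (j <= N)%N -> state_at r j = (enum_rank (q j), v j).
    move=> jN; rewrite state_atE ?szw //; case: j jN => //= j jN.
    by rewrite (nth_map x0) ?szw // nth_mkseq.
  exists r; split; first by rewrite /= q_0 v0.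
  + apply/(valid_steps_nth _ _ x0) => j; rewrite /= szw => jN.
    rewrite nth_mkseq //= -[nth _ _ _]/(nth (start r) (start r :: unzip2 (steps r)) j).
    by rewrite -state_atE ?szw ?(ltnW jN) // stE ?(ltnW jN) //; exact: eP.
  + have -> : r = run_suffix r 0 by rewrite /run_suffix take0 drop0.
    apply/wsat_suffix => //; rewrite /run_length /= szw.
    apply: (proj2 (tsat_eq _ _ _ _)) sat => //.
    * by move=> i iN; rewrite stE //= ffunE enum_rankK.
    * elim=> [|j IH] jN; first by rewrite /tcost big_ord0 /run_cost /= take0.
      rewrite (run_costS x0) ?szw // mk_pta_cost addr0 IH ?(ltnW jN) // tcostS.
      by rewrite nth_mkseq //= stE ?(ltnW jN) //= ffunE enum_rankK.
Qed.

End MkPta.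

(** * The automaton and the formula of a counter machine *)

Inductive phase := PhS | PhE | PhG.

Definition ord_of_phase (p : phase) : 'I_3 :=
  match p with PhS => inord 0 | PhE => inord 1 | PhG => inord 2 end.

Definition phase_of_nat (i : nat) : phase :=
  match i with 0 => PhS | 1 => PhE | _ => PhG end.

Lemma ord_of_phaseK : cancel ord_of_phase (phase_of_nat \o val).
Proof. by case; rewrite /= inordK. Qed.

HB.instance Definition _ := Finite.copy phase (can_type ord_of_phaseK).

Definition wand p q := WNot (WOr (WNot p) (WNot q)).
Definition wimp p q := WOr (WNot p) q.
Definition wtrue := WOr (WAtom 0) (WNot (WAtom 0)).

Definition link (a c : nat) : wmtl :=
  wimp (WAtom a) (WUntil wtrue CEq c (WAtom 0)).

(** With [K = k.+1], the bounds [7 * k + 6], [7 * k + 5] and [7 * k + 3] are [7K - w] for [w] = 1,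
    2, 4. The left argument [WNot (WAtom 1)] makes 7 the cost to the very next entry of E, whereas
    [link] allows any later entry of S; the costs single out the right one. *)
Definition obligations (k : nat) : wmtl :=
  wand (wimp (WAtom 1) (WUntil (WNot (WAtom 1)) CEq 7 (WAtom 1)))
  (wand (link 2 (7 * k + 6)) (wand (link 3 (7 * k + 5)) (link 5 (7 * k + 3)))).

(** E is entered in block [b] at cost [2 + 7b], so the first bound places the exit of the loading
    loop in the first block of round [n.+1]. The bound [CGe 0] holds trivially. *)
Definition simulation_formula (n k : nat) : wmtl :=
  wand (WUntil (WAtom 6) CEq (2 + 7 * (k.+1 * n.+1)) (WAtom 7))
       (WUntil (obligations k) CGe 0 (WAtom 8)).

Section Formulas.
Variables (R : realType) (N : nat) (lab : nat -> seq nat) (C : nat -> R).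

Lemma tsat_and j p q : tsat N lab C j (wand p q) <->
  tsat N lab C j p /\ tsat N lab C j q.
Proof.
split=> /= [H|[Hp Hq] [Np|Nq]] //.
by split; apply: contrapT => Nx; apply: H; [left|right].
Qed.

Lemma tsat_imp j p q : tsat N lab C j (wimp p q) <->
  (tsat N lab C j p -> tsat N lab C j q).
Proof.
split=> /= [[Np|] //|H]; have [Hp|Np] := EM (tsat N lab C j p).
  by right; apply: H.
by left.
Qed.

Lemma tsat_true j : tsat N lab C j wtrue.
Proof. by rewrite /=; case: (0%N \in _); [left|right]. Qed.

Definition linked j c := exists k, [/\ (j < k <= N)%N, 0%N \in lab k & C k - C j = c%:R].

Lemma tsat_link j a c :
  tsat N lab C j (link a c) <-> (a \in lab j -> linked j c).
Proof.
rewrite tsat_imp; split=> H /H [k []]; first by move=> *; exists k.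
by move=> *; exists k; split=> // i _; exact: tsat_true.
Qed.

Lemma tsat_obligations j k : tsat N lab C j (obligations k) <->
  [/\ 1%N \in lab j -> exists i, [/\ (j < i <= N)%N, 1%N \in lab i,
        forall h, (j < h < i)%N -> 1%N \notin lab h & C i - C j = 7],
      2%N \in lab j -> linked j (7 * k + 6),
      3%N \in lab j -> linked j (7 * k + 5)
    & 5%N \in lab j -> linked j (7 * k + 3)].
Proof.
rewrite /obligations !tsat_and !tsat_link tsat_imp; split=> [[H1 [H2 [H3 H4]]]|[H1 *]].
  split=> // /H1 [i [ji iN H Ci]]; exists i; split=> // h jh.
  by apply/negP; exact: H.
split=> // /H1 [i [ji iN H Ci]]; exists i; split=> // h jh.
by apply/negP; exact: H.
Qed.

End Formulas.

Section MachinePta.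
Variables (T : finType) (tr : T -> instr) (k : nat).
Notation K := k.+1.

Definition loc : Type := option (phase * (T * 'I_K)).

(** The instruction at program counter 0 forces clock value 1 in every block, which initialises all
    counters to 0. *)
Definition guard (x : T * 'I_K) : constraint :=
  let t := tr x.1 in
  if src t == 0%N then CAtom CEq 1 else
  match act t with
  | OZero r => if r == x.2 then CAtom CEq 1 else CAtom CLe 1
  | ODec r => if r == x.2 then CAtom CLt 1 else CAtom CLe 1
  | _ => CAtom CLe 1
  end.

Definition weight (x : T * 'I_K) : nat :=
  match act (tr x.1) with
  | OInc r => if r == x.2 then 1 else 2
  | ODec r => if r == x.2 then 4 else 2
  | _ => 2
  end.

Definition next (x x' : T * 'I_K) : bool :=
  if x.2 == k :> nat then (x'.2 == 0 :> nat) && (src (tr x'.1) == dst (tr x.1))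
  else (x'.1 == x.1) && (x'.2 == x.2.+1 :> nat).

Definition loc_edge (l l' : loc) : option (constraint * bool) :=
  match l, l' with
  | None, Some (PhS, x) =>
      if (src (tr x.1) == 0%N) && (x.2 == 0 :> nat)
      then Some (CAtom CGe 0, true) else None
  | Some (PhS, x), Some (PhE, x') =>
      if x == x' then Some (guard x, false) else None
  | Some (PhE, x), Some (PhG, x') =>
      if x == x' then Some (CAtom CEq 1, false) else None
  | Some (PhG, x), Some (PhS, x') =>
      if next x x' then Some (CAtom CGe 0, true) else None
  | _, _ => None
  end.

Definition loc_rate (l : loc) : nat :=
  match l with
  | None => 0
  | Some (PhS, _) => 2
  | Some (PhE, x) => weight x
  | Some (PhG, _) => 1
  end.

(* Atoms 0 and 1 mark the entries of S and E, atom w + 1 the entry of G with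
   weight w.  The program counter 0 is initial, 1 is the loop loading the input,
   2 is halting and 3 is the start of the program; accordingly atom 6 marks the
   loading phase, atom 7 its last round and atom 8 the halting rounds. *)
Definition loc_label (l : loc) : seq nat :=
  match l with
  | None => [::]
  | Some (p, x) =>
    let t := tr x.1 in
    (if (src t <= 1)%N then [:: 6%N] else [::]) ++
    match p with
    | PhS => 0%N :: (if src t == 2%N then [:: 8%N] else [::])
    | PhE => 1%N :: (if (src t == 1%N) && (dst t == 3%N) then [:: 7%N] else [::])
    | PhG => [:: (weight x).+1]
    end
  end.

Definition machine_pta : pta := mk_pta (None : loc) loc_edge loc_rate loc_label.

(** Indices are rounds. Round 0 enters the loading loop, rounds 1 to [n] iterate it and round [n.+1]
    leaves it. *)
Definition accepting (n : nat) : Prop :=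
  exists M (tau : nat -> T) (sigma : nat -> store),
  [/\ sigma 0%N = (fun=> 0%N) /\ src (tr (tau 0%N)) = 0%N,
      forall m, (m < M)%N ->
        [/\ enabled (act (tr (tau m))) (sigma m),
            sigma m.+1 = apply_op (act (tr (tau m))) (sigma m)
          & dst (tr (tau m)) = src (tr (tau m.+1))],
      src (tr (tau M)) = 2%N,
      (n.+1 < M)%N /\ (forall m, (m <= n)%N -> dst (tr (tau m)) = 1%N)
    & src (tr (tau n.+1)) = 1%N /\ dst (tr (tau n.+1)) = 3%N].

Definition op_lt (n : nat) (o : op) : bool :=
  match o with OInc r | ODec r | OZero r => (r < n)%N | ONop => true end.

Lemma weight_cases x : weight x \in [:: 1; 2; 4]%N.
Proof. by rewrite /weight; case: (act _) => [r|r|r|] //; case: eqP. Qed.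

Lemma lab0 l : (0%N \in loc_label l) = if l is Some (PhS, _) then true else false.
Proof.
case: l => [[[] x]|] //=; rewrite mem_cat; case: ifP => //= _;
  rewrite !inE //; by case: ifP.
Qed.

Lemma lab1 l : (1%N \in loc_label l) = if l is Some (PhE, _) then true else false.
Proof.
case: l => [[[] x]|] //=; rewrite mem_cat; case: ifP => //= _;
  rewrite !inE //; try (by case: ifP); by have := weight_cases x; rewrite !inE; lia.
Qed.

Lemma lab_link w l : w \in [:: 1; 2; 4]%N -> (w.+1 \in loc_label l) =
  if l is Some (PhG, x) then w == weight x else false.
Proof.
move=> w3; have {w3} /or3P[] : [|| w == 1, w == 2 | w == 4]%N by rewrite !inE in w3.
all: move=> /eqP ->; case: l => [[[] x]|] //=; rewrite mem_cat; case: ifP => //= _.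
all: rewrite ?inE //; by case: ifP.
Qed.

Lemma lab6 l : (6%N \in loc_label l) =
  if l is Some (_, x) then (src (tr x.1) <= 1)%N else false.
Proof.
case: l => [[p x]|] //=; rewrite mem_cat; case: ifP => //= _.
case: p; rewrite ?inE /=; try (by case: ifP).
by have := weight_cases x; rewrite !inE; lia.
Qed.

Lemma lab7 l : (7%N \in loc_label l) =
  if l is Some (PhE, x) then (src (tr x.1) == 1%N) && (dst (tr x.1) == 3%N) else false.
Proof.
case: l => [[p x]|] //=; rewrite mem_cat; case: ifP => //= _.
all: case: p; rewrite ?inE /=; try (by case: ifP).
all: by have := weight_cases x; rewrite !inE; lia.
Qed.

Lemma lab8 l : (8%N \in loc_label l) =
  if l is Some (PhS, x) then src (tr x.1) == 2%N else false.
Proof.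
case: l => [[p x]|] //=; rewrite mem_cat; case: ifP => //= _.
all: case: p; rewrite ?inE /=; try (by case: ifP).
all: by have := weight_cases x; rewrite !inE; lia.
Qed.

End MachinePta.

(** * Counter values as clock values *)

Section Values.
Variables (R : realType) (T : finType) (tr : T -> instr) (k : nat).
Notation K := k.+1.

Definition value (c : nat) : R := 2^-1 ^+ c.

Lemma value_gt0 c : 0 < value c.
Proof. by rewrite exprn_gt0 // invr_gt0. Qed.

Lemma valueS c : 2 * value c.+1 = value c.
Proof. by rewrite /value exprS mulrA divff ?mul1r // pnatr_eq0. Qed.

Lemma value_le1 c : value c <= 1.
Proof. by rewrite exprn_ile1 // ?invr_ge0 // invf_le1 // ler1n. Qed.

Lemma value_lt1 c : (value c < 1) = (0 < c)%N.
Proof.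
case: c => [|c]; first by rewrite /value expr0 ltxx.
have -> // : value c.+1 < 1.
by have := valueS c; have := value_le1 c; have := value_gt0 c; lra.
Qed.

Lemma value_eq1 c : (value c = 1) <-> (c = 0)%N.
Proof.
split=> [v1|->]; last by rewrite /value expr0.
by case: c v1 => // c v1; have := value_lt1 c.+1; rewrite v1 ltxx.
Qed.

(** The equation [2y' = wy] for one instruction. For a decrement, [enabled] excludes the truncated
    predecessor of 0. *)
Lemma value_apply t (i : 'I_K) s : enabled (act (tr t)) s ->
  2 * value (apply_op (act (tr t)) s i) = (weight tr (t, i))%:R * value (s i).
Proof.
rewrite /weight /=; case: (act (tr t)) => [r|r|r|] //= en.
  rewrite /upd (eq_sym r); case: eqP => [<-|//].
  by rewrite valueS mul1r.
rewrite /upd (eq_sym r); case: eqP => [ir|//].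
by rewrite -ir in en *; rewrite -(valueS (s i).-1) prednK // mulrA -natrM.
Qed.

Lemma guard_le1 (x : T * 'I_K) (v : R) : csat v (guard tr x) -> v <= 1.
Proof.
rewrite /guard; case: ifP => _ /=; first by move=> ->.
case: (act _) => [r|r|r|] //=; case: ifP => _ //=; first exact: ltW.
by move=> ->.
Qed.

End Values.

(** * From runs to computations *)

Section Soundness.
Variables (R : realType) (T : finType) (tr : T -> instr) (k : nat).
Notation K := k.+1.
Notation loc := (loc T k).
Variables (N : nat) (q : nat -> loc) (v d : nat -> R).
Hypothesis pth : tpath None (@loc_edge T tr k) N q v d.
Notation C := (tcost (@loc_rate T tr k) q d).

Lemma step_init j x : (j < N)%N -> q j = None -> q j.+1 = Some x ->
  [/\ x.1 = PhS, src (tr x.2.1) = 0%N, x.2.2 = ord0 & v j.+1 = 0].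
Proof.
move=> jN q0 q1; case: pth => _ _ /(_ j jN) [_ [g [b []]]].
rewrite q0 q1; case: x {q1} => [[] x] //=; case: ifP => // /andP[/eqP s0 /eqP i0].
by case=> _ <- _ ->; split=> //; apply: val_inj.
Qed.

Lemma step_S j x : (j < N)%N -> q j = Some (PhS, x) ->
  [/\ q j.+1 = Some (PhE, x), csat (v j.+1) (guard tr x) & v j.+1 = v j + d j].
Proof.
move=> jN q0; case: pth => _ _ /(_ j jN) [_ [g [b []]]].
rewrite q0; case: (q j.+1) => [[[] y]|] //=; case: eqP => // <-.
by case=> <- <- cs ->.
Qed.

Lemma step_E j x : (j < N)%N -> q j = Some (PhE, x) ->
  [/\ q j.+1 = Some (PhG, x), v j + d j = 1 & v j.+1 = 1].
Proof.
move=> jN q0; case: pth => _ _ /(_ j jN) [_ [g [b []]]].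
rewrite q0; case: (q j.+1) => [[[] y]|] //=; case: eqP => // <-.
by case=> <- <- /= cs ->.
Qed.

Lemma step_G j x : (j < N)%N -> q j = Some (PhG, x) ->
  exists x', [/\ q j.+1 = Some (PhS, x'), next tr x x' & v j.+1 = 0].
Proof.
move=> jN q0; case: pth => _ _ /(_ j jN) [_ [g [b []]]].
rewrite q0; case: (q j.+1) => [[[] y]|] //=; case: ifP => // nx.
by case=> _ <- _ ->; exists y.
Qed.

Lemma cost_le i j : (i <= j <= N)%N -> C i <= C j.
Proof.
case/andP; elim: j => [|j IH]; first by rewrite leqn0 => /eqP ->.
rewrite leq_eqVlt => /predU1P[-> //|ij] jN; apply: le_trans (IH _ _) _; try lia.
rewrite tcostS lerDl mulr_ge0 //.
by case: pth => _ _ /(_ j jN) [].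
Qed.

(** Position 0 is the initial location; block [b] occupies the positions [3b + 1], [3b + 2] and
    [3b + 3], in S, E and G. *)
Lemma block_start b : (3 * b + 1 <= N)%N ->
  exists x, [/\ q (3 * b + 1) = Some (PhS, x) & v (3 * b + 1) = 0].
Proof.
elim: b => [|b IH] bN.
  rewrite muln0 add0n in bN *; case: pth => q0 _ /(_ 0%N bN) [_ [g [c []]]].
  case q1: (q 1) => [[p x]|]; last by rewrite q0.
  by case: (step_init bN q0 q1) => /= -> _ _ v1 _ _ _; exists x.
have [|x [qS _]] := IH; first by lia.
have b1 : (3 * b + 1 < N)%N by lia.
have b2 : (3 * b + 2 < N)%N by lia.
have b3 : (3 * b + 3 < N)%N by lia.
have [] := step_S b1 qS; rewrite -addnS => qE _ _.
have [] := step_E b2 qE; rewrite -addnS => qG _ _.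
have [x' []] := step_G b3 qG; rewrite -addnS => qS' _ v0.
by exists x'; rewrite (_ : (3 * b.+1 + 1)%N = (3 * b + 4)%N); [split|lia].
Qed.

Lemma block_event b x : (3 * b + 2 <= N)%N -> q (3 * b + 1) = Some (PhS, x) ->
  [/\ q (3 * b + 2) = Some (PhE, x), csat (v (3 * b + 2)) (guard tr x),
      0 <= v (3 * b + 2)
    & C (3 * b + 2) = C (3 * b + 1) + 2 * v (3 * b + 2)].
Proof.
move=> bN qS; have b1 : (3 * b + 1 < N)%N by lia.
have [] := step_S b1 qS; rewrite -addnS => qE cs vE.
have [y [qS' v0]] := block_start (ltnW b1).
split=> //; first exact: tpath_ge0 pth bN.
by rewrite [in LHS]addnS tcostS qS /= vE v0 add0r mulrC.
Qed.

Lemma block_end b x : (3 * b + 3 <= N)%N -> q (3 * b + 1) = Some (PhS, x) ->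
  q (3 * b + 3) = Some (PhG, x) /\
  C (3 * b + 3) = C (3 * b + 2) + (weight tr x)%:R * (1 - v (3 * b + 2)).
Proof.
move=> bN qS; have b2 : (3 * b + 2 < N)%N by lia.
have [qE _ _ _] := block_event (ltnW b2) qS.
have [] := step_E b2 qE; rewrite -addnS => qG vd _; split=> //.
rewrite [in LHS]addnS tcostS qE /= mulrC (_ : d _ = 1 - v (3 * b + 2)) //.
by move: vd; lra.
Qed.

Lemma block_next b x x' : (3 * b.+1 + 1 <= N)%N ->
  q (3 * b + 1) = Some (PhS, x) -> q (3 * b.+1 + 1) = Some (PhS, x') ->
  next tr x x'.
Proof.
move=> bN qS qS'; have b3 : (3 * b + 3 < N)%N by lia.
have [qG _] := block_end (ltnW b3) qS.
have [y []] := step_G b3 qG.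
rewrite (_ : (3 * b + 3).+1 = 3 * b.+1 + 1)%N; last by lia.
by rewrite qS' => -[<-].
Qed.

Lemma position_cases j : (0 < j)%N ->
  exists b r, (r < 3)%N /\ j = (3 * b + r.+1)%N.
Proof. by move=> j0; exists (j.-1 %/ 3)%N, (j.-1 %% 3)%N; lia. Qed.

Lemma in_block b x r : (3 * b + r.+1 <= N)%N -> (r < 3)%N ->
  q (3 * b + 1) = Some (PhS, x) ->
  exists p, q (3 * b + r.+1) = Some (p, x) /\
    (r = match p with PhS => 0 | PhE => 1 | PhG => 2 end)%N.
Proof.
case: r => [|[|[|//]]] bN _ qS; first by exists PhS.
  by exists PhE; case: (block_event bN qS).
by exists PhG; case: (block_end bN qS).
Qed.

Variable n : nat.
Hypothesis sat : tsat N (fun j => loc_label tr (q j)) C 0 (simulation_formula n k).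
Hypothesis act_lt : forall t, op_lt K (act (tr t)).
Hypothesis nop0 : forall t, src (tr t) = 0%N -> act (tr t) = ONop.
Hypothesis dst_gt0 : forall t, dst (tr t) != 0%N.

(** The costs first fix when E is entered in each block, then the links relate the values of
    consecutive rounds, and finally the guards show that every instruction is enabled. *)
Lemma soundness : accepting tr n.
Proof.
case/tsat_and: sat.
case=> e [/andP[e0 eN] lab_e before_e Ce] [p [/andP[p0 pN] lab_p obl_p _]].
rewrite /= lab7 in lab_e; rewrite /= lab8 in lab_p.
have C0 : C 0 = 0 by rewrite /tcost big_ord0.
rewrite /= C0 subr0 in Ce.
(* Positions before [e] have program counter at most 1, while [p] has program counter 2. *)
have ep : (e < p)%N.
  rewrite ltnNge leq_eqVlt; apply/negP => /predU1P[pe|pe].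
    by rewrite pe in lab_p; case: (q e) lab_e lab_p => [[[] ?]|].
  have := before_e p; rewrite /= lab6 p0 pe => /(_ isT).
  by case: (q p) lab_p => [[[] x]|] //= /eqP ->.
have {obl_p} obl j : (0 < j < p)%N -> _ :=
  fun H => proj1 (tsat_obligations _ _ _ _ _) (obl_p j H).
have [bp [rp [rp3 pE]]] := position_cases p0.
have [xp [qp _]] : exists x, [/\ q (3 * bp + 1) = Some (PhS, x) & v (3 * bp + 1) = 0].
  by apply: block_start; lia.
have rp0 : rp = 0%N.
  have [|p' [qp' ->]] := in_block _ rp3 qp; first by lia.
  by rewrite pE qp' in lab_p; case: p' lab_p {qp'}.
rewrite {}rp0 in pE rp3; rewrite pE qp in lab_p.
have [be [re [re3 eE]]] := position_cases e0.
have [xe [qe _]] : exists x, [/\ q (3 * be + 1) = Some (PhS, x) & v (3 * be + 1) = 0].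
  by apply: block_start; lia.
have re1 : re = 1%N.
  have [|p' [qp' ->]] := in_block _ re3 qe; first by lia.
  by rewrite eE qp' in lab_e; case: p' lab_e {qp'}.
rewrite {}re1 in eE re3.
have [qe' _ _ _] : _ := block_event (b := be) (x := xe) (ltac:(lia)) qe.
rewrite eE qe' in lab_e; case/andP: lab_e => /eqP src_e /eqP dst_e.
have ebp : (be < bp)%N by lia.
have q1 : exists x, [/\ q 1 = Some (PhS, x), src (tr x.1) = 0%N & x.2 = ord0].
  have [|x [qx _]] := block_start (b := 0); first by lia.
  have q0 : q 0%N = None by case: pth.
  have [|_ s0 x0 _] := step_init _ q0 qx; first by lia.
  by exists x.
have timeE b : (2 + 7 * b)%:R = 2 + 7 * b%:R :> R by rewrite natrD natrM.
(* The initial location is free, and in block 0 the guard forces a delay of 1 at rate 2, whence the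
   2. The obligation at each E supplies the next E, so the run extends beyond [p] at least to the E
   of block [bp]. *)
have cost_E b : (b <= bp)%N -> (3 * b + 2 <= N)%N /\ C (3 * b + 2) = (2 + 7 * b)%:R.
  elim: b => [|b IH] bb.
    split; first by lia.
    have [x [qx s0 _]] := q1.
    have [_ cs _ ->] := block_event (b := 0) (ltac:(lia) : (3 * 0 + 2 <= N)%N) qx.
    move: cs; rewrite /guard s0 eqxx /= => ->.
    rewrite tcostS /tcost big_ord0 /=; case: pth => -> _ _ /=; lra.
  have [bN CE] := IH (ltnW bb).
  have [x [qx _]] := block_start (ltnW (ltac:(lia) : (3 * b + 1 < N)%N)).
  have [qx' _ _ _] := block_event bN qx.
  have [H _ _ _] := obl (3 * b + 2)%N (ltac:(lia)).
  rewrite lab1 qx' in H; have [i [/andP[bi iN] lab_i between Ci]] := H isT.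
  have [x' [qS _]] := block_start (ltac:(lia) : (3 * b.+1 + 1 <= N)%N).
  have iE : i = (3 * b.+1 + 2)%N.
    have [|i4] := leqP i (3 * b + 4).
      move=> i4; have : i = (3 * b + 3)%N \/ i = (3 * b.+1 + 1)%N by lia.
      case=> iE; rewrite lab1 iE in lab_i; last by rewrite qS in lab_i.
      have [|qG _] := block_end _ qx; first by lia.
      by rewrite qG in lab_i.
    apply/eqP; rewrite eqn_leq andbC; apply/andP; split; first by lia.
    rewrite leqNgt; apply/negP => i5; have := between (3 * b.+1 + 2)%N (ltac:(lia)).
    by have [|-> _ _ _] := block_event _ qS; [lia|rewrite lab1].
  rewrite -iE; split=> //.
  by rewrite mulnS [(7 + _)%N]addnC addnA natrD -CE; move: Ci; lra.
have y_bounds b x : (b <= bp)%N -> q (3 * b + 1) = Some (PhS, x) ->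
    0 <= v (3 * b + 2) <= 1.
  move=> bb qx; have [bN _] := cost_E b bb.
  by have [_ /guard_le1 -> ->] := block_event bN qx.
have transfer b x : (b + K <= bp)%N -> q (3 * b + 1) = Some (PhS, x) ->
    0 < v (3 * b + 2) ->
    2 * v (3 * (b + K) + 2) = (weight tr x)%:R * v (3 * b + 2).
  move=> bb qx y0; have /andP[_ y1] := y_bounds b x (ltac:(lia)) qx.
  have [_ CE] := cost_E b (ltac:(lia)).
  have [qG] := block_end (ltac:(lia) : (3 * b + 3 <= N)%N) qx.
  rewrite CE => CG.
  have w3 := weight_cases tr x.
  have : linked N (fun j => loc_label tr (q j)) C (3 * b + 3) (7 * k + (7 - weight tr x)).
    have [_ H2 H3 H5] := obl (3 * b + 3)%N (ltac:(lia)).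
    have : (weight tr x).+1 \in loc_label tr (q (3 * b + 3)%N).
      by rewrite lab_link // qG.
    by move: w3; rewrite !inE => /or3P[] /eqP ->.
  case=> j [/andP[bj jN]]; rewrite lab0 => lab_j Cj.
  have [b' [r' [r3 jE]]] := position_cases (ltac:(lia) : (0 < j)%N).
  have [x' [qx' v0]] := block_start (ltac:(lia) : (3 * b' + 1 <= N)%N).
  have r0 : r' = 0%N.
    have [|p' [qp' ->]] := in_block _ r3 qx'; first by lia.
    by rewrite jE qp' in lab_j; case: p' lab_j {qp'}.
  rewrite {}r0 in jE r3; rewrite jE CG in Cj.
  have {}Cj : C (3 * b' + 1) =
      2 + 7 * (b + K)%:R - (weight tr x)%:R * v (3 * b + 2).
    have E2 : (7 * k + (7 - weight tr x))%:R = 7 * k%:R + (7 - (weight tr x)%:R) :> R.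
      by rewrite natrD natrM natrB //; move: w3; rewrite !inE; lia.
    have E3 : (b + K)%:R = b%:R + (k%:R + 1) :> R by rewrite natrD -natr1.
    by move: Cj; rewrite timeE E2 E3; lra.
  have w0 : 1 <= (weight tr x)%:R :> R.
    by rewrite ler1n; move: w3; rewrite !inE; lia.
  have w4 : (weight tr x)%:R <= 4 :> R.
    by rewrite ler_nat; move: w3; rewrite !inE; lia.
  have wy0 : 0 < (weight tr x)%:R * v (3 * b + 2) by rewrite mulr_gt0 //; lra.
  have wy4 : (weight tr x)%:R * v (3 * b + 2) <= 4.
    by rewrite -[leRHS]mulr1 ler_pM //; lra.
  (* A block after [bp] would start at cost at least [2 + 7bp], which exceeds [2 + 7(b + K) - wy]
     because [wy] is positive. *)
  have [bb'|bb'] := ltnP bp b'.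
    have := @cost_le (3 * bp + 2) (3 * b' + 1) (ltac:(lia)).
    have [_ ->] := cost_E bp (leqnn _).
    have : (b + K)%:R <= bp%:R :> R by rewrite ler_nat.
    by rewrite Cj timeE; lra.
  have [b'N CE'] := cost_E b' bb'.
  have := y_bounds b' x' bb' qx'.
  have [_ _ _] := block_event b'N qx'; rewrite CE' Cj timeE => E' /andP[y'0 y'1].
  (* S is entered in block [b'] at cost [2 + 7b' - 2y'], so [7(b' - b - K) = 2y' - wy] with
     [0 <= 2y' <= 2] and [0 < wy <= 4]. The only multiple of 7 in this range is 0. *)
  have bE : b' = (b + K)%N.
    have [lt|gt|//] := ltngtP b' (b + K).
      by move: lt; rewrite -(ler_nat R) -natr1 => lt; exfalso; lra.
    by move: gt; rewrite -(ler_nat R) -natr1 => gt; exfalso; lra.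
  by subst b'; lra.
have [x1 [q1x src_x1 i_x1]] := q1.
pose tau m := if q (3 * (m * K) + 1)%N is Some (_, x) then x.1 else x1.1.
have block_at m i : (i < K)%N -> (m * K + i <= bp)%N ->
    q (3 * (m * K + i) + 1)%N = Some (PhS, (tau m, inord i)).
  elim: m i => [|m IHm] i; elim: i => [|i IHi] iK ib.
  - rewrite !addn0 /tau mul0n muln0 add0n q1x; case: (x1) i_x1 => t i /= ->.
    by congr (Some (_, (_, _))); apply: val_inj; rewrite /= inordK.
  - have [x' [qx' _]] := block_start (ltac:(lia) : (3 * (0 * K + i.+1) + 1 <= N)%N).
    have nx := block_next (b := (0 * K + i)%N) (ltac:(lia))
      (IHi (ltac:(lia)) (ltac:(lia))) (ltac:(by rewrite -addnS qx')).
    rewrite qx'; move: nx; rewrite /next /= inordK ?(ltnW iK) // ifF; last by lia.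
    case: x' {qx'} => t i' /= /andP[/eqP -> /eqP i'E].
    by congr (Some (_, (_, _))); apply: val_inj; rewrite /= inordK // i'E.
  - have [x' [qx' _]] := block_start (ltac:(lia) : (3 * (m.+1 * K + 0) + 1 <= N)%N).
    have bE : (m.+1 * K = (m * K + k).+1)%N by lia.
    have nx := block_next (b := (m * K + k)%N) (ltac:(lia))
      (IHm k (ltac:(lia)) (ltac:(lia)))
      (ltac:(by rewrite -bE -[(m.+1 * K)%N]addn0 qx')).
    move: nx; rewrite /next /= inordK // eqxx => /andP[/eqP i'0 _].
    rewrite /tau -[(m.+1 * K)%N in RHS]addn0 qx'; case: x' {qx'} i'0 => t i' /= i'0.
    by congr (Some (_, (_, _))); apply: val_inj; rewrite /= inordK.
  - have [x' [qx' _]] := block_start (ltac:(lia) : (3 * (m.+1 * K + i.+1) + 1 <= N)%N).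
    have nx := block_next (b := (m.+1 * K + i)%N) (ltac:(lia))
      (IHi (ltac:(lia)) (ltac:(lia))) (ltac:(by rewrite -addnS qx')).
    rewrite qx'; move: nx; rewrite /next /= inordK ?(ltnW iK) // ifF; last by lia.
    case: x' {qx'} => t i' /= /andP[/eqP -> /eqP i'E].
    by congr (Some (_, (_, _))); apply: val_inj; rewrite /= inordK // i'E.
have tau_next m : (m.+1 * K <= bp)%N -> dst (tr (tau m)) = src (tr (tau m.+1)).
  move=> mb; have bE : (m.+1 * K = (m * K + k).+1)%N by lia.
  have qS' := block_at m.+1 0%N isT (ltac:(lia)); rewrite addn0 bE in qS'.
  have nx := block_next (b := (m * K + k)%N) (ltac:(lia))
    (block_at m k (ltac:(lia)) (ltac:(lia))) qS'.
  by move: nx; rewrite /next /= inordK // eqxx => /andP[_ /eqP ->].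
pose sigma := nat_rect (fun=> store) (fun=> 0%N)
  (fun m s => apply_op (act (tr (tau m))) s).
have tau0 : src (tr (tau 0)) = 0%N by rewrite /tau mul0n muln0 q1x.
(* The guard that matters is the one in the block of the tested counter, which may be any block of
   the round; hence the bound on the last one. *)
have sigma_enabled m : (m * K + k <= bp)%N ->
    (forall i, (i < K)%N -> v (3 * (m * K + i) + 2)%N = value R (sigma m i)) ->
    enabled (act (tr (tau m))) (sigma m).
  move=> mb val_m.
  have G i : (i < K)%N -> csat (value R (sigma m i)) (guard tr (tau m, inord i : 'I_K)).
    move=> iK; have [iN _] := cost_E (m * K + i)%N (ltac:(lia)).
    by have [_] := block_event iN (block_at m i iK (ltac:(lia))); rewrite val_m.
  have := act_lt (tau m); have := @nop0 (tau m).
  case aE: (act (tr (tau m))) => [r|r|r|] //= nop rK; have := G r rK;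
    rewrite /guard /= aE inordK // eqxx; case: eqP => [/nop //|_] /=.
    by rewrite value_lt1.
  by move/value_eq1.
(* By induction on rounds: [transfer] and [value_apply] have the same right-hand side, and the
   values of round [m] make its instruction enabled. *)
have values m i : (i < K)%N -> (m * K + i <= bp)%N ->
    v (3 * (m * K + i) + 2)%N = value R (sigma m i).
  elim: m i => [|m IH] i iK ib.
    have -> : value R (sigma 0%N i) = 1 by apply/value_eq1.
    have [iN _] := cost_E (0 * K + i)%N ib.
    have [_] := block_event iN (block_at 0%N i iK ib).
    by rewrite /guard tau0.
  have val_m j : (j < K)%N -> v (3 * (m * K + j) + 2)%N = value R (sigma m j).
    by move=> jK; apply: IH => //; lia.
  have en := sigma_enabled m (ltac:(lia)) val_m.
  have := transfer _ _ (ltac:(lia) : (m * K + i + K <= bp)%N)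
    (block_at m i iK (ltac:(lia))).
  rewrite val_m // value_gt0 => /(_ isT).
  have := value_apply R (inord i : 'I_K) en; rewrite inordK // => <-.
  rewrite (_ : (m * K + i + K)%N = (m.+1 * K + i)%N); last by lia.
  by move=> E2; apply: (@mulfI _ 2) => //; rewrite pnatr_eq0.
(* Atom 8 marks every block of a halting round, so [bp] need not be the first block of its round. *)
pose M := (bp %/ K)%N.
have ME : bp = (M * K + bp %% K)%N by exact: divn_eq.
have bpK : (bp %% K < K)%N by rewrite ltn_mod.
have tauM : src (tr (tau M)) = 2%N.
  move: lab_p; have := block_at M _ bpK (ltac:(lia)).
  by rewrite -ME qp => -[->] /eqP.
(* Both [2 + 7be] and the bound in the formula are the cost at [e]. *)
have beE : be = (n.+1 * K + 0)%N.
  have [_ Cbe] := cost_E be (ltnW ebp).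
  by move: Ce; rewrite eE Cbe => /eqP; rewrite eqr_nat => /eqP; lia.
have tau_e : tau n.+1 = xe.1.
  by have := block_at n.+1 0%N isT (ltac:(lia)); rewrite -beE qe => -[->].
have nM : (n.+1 < M)%N.
  have : (n.+1 <= M)%N by rewrite leq_divRL //; lia.
  rewrite leq_eqVlt => /predU1P[nM|//].
  by move: tauM; rewrite -nM tau_e src_e.
have MK m : (m < M)%N -> (m.+1 * K <= bp)%N.
  by rewrite -leq_divRL.
exists M, tau, sigma; split => //.
- move=> m mM; have := MK m mM => mb; split=> //; last exact: tau_next.
  by apply: sigma_enabled => [|i iK]; [lia|apply: values => //; lia].
(* Atom 6 before [e] bounds the program counter by 1, and [dst_gt0] excludes 0. *)
- split=> // m mn; have := dst_gt0 (tau m).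
  rewrite tau_next; last by apply: MK; lia.
  have mb : (m.+1 * K + 0 <= bp)%N by rewrite addn0; apply: MK; lia.
  have mn' : (m.+1 * K <= n.+1 * K)%N by rewrite leq_mul2r orbC ltnS mn.
  have [eq|lt] : m.+1 = n.+1 \/ (m.+1 * K < n.+1 * K)%N.
  + by move: mn'; rewrite leq_eqVlt eqn_mul2r /= => /predU1P[]; [left|right].
  + by rewrite eq tau_e src_e.
  + have := before_e (3 * (m.+1 * K + 0) + 1)%N (ltac:(lia)).
    by rewrite /= lab6 block_at //=; lia.
- by rewrite tau_e.
Qed.

End Soundness.

(** * From computations to runs *)

Section Completeness.
Variables (R : realType) (T : finType) (tr : T -> instr) (k : nat).
Notation K := k.+1.
Variables (M : nat) (tau : nat -> T) (sigma : nat -> store).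

Definition block (b : nat) : T * 'I_K := (tau (b %/ K), inord (b %% K)).
Definition bvalue (b : nat) : R := value R (sigma (b %/ K)%N (b %% K)%N).

Definition tloc (j : nat) : loc T k :=
  if j is j'.+1 then Some (phase_of_nat (j' %% 3), block (j' %/ 3)) else None.

Definition tclock (j : nat) : R :=
  if j is j'.+1 then
    match (j' %% 3)%N with 0 => 0 | 1 => bvalue (j' %/ 3) | _ => 1 end
  else 0.

(* The waiting time in [PhG] makes consecutive [PhE]-events 7 apart. *)
Definition tdelay (j : nat) : R :=
  if j is j'.+1 then let b := (j' %/ 3)%N in
    match (j' %% 3)%N with
    | 0 => bvalue b
    | 1 => 1 - bvalue b
    | _ => 7 - (weight tr (block b))%:R * (1 - bvalue b) - 2 * bvalue b.+1
    end
  else 0.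

Notation C := (tcost (@loc_rate T tr k) tloc tdelay).

Lemma bvalue_gt0 b : 0 < bvalue b. Proof. exact: value_gt0. Qed.
Lemma bvalue_le1 b : bvalue b <= 1. Proof. exact: value_le1. Qed.

Lemma position_div b r : (r < 3)%N ->
  ((3 * b + r) %/ 3 = b)%N /\ ((3 * b + r) %% 3 = r)%N.
Proof. by lia. Qed.

Lemma tlocE b r : (r < 3)%N ->
  tloc (3 * b + r.+1) = Some (phase_of_nat r, block b).
Proof. by move=> r3; rewrite addnS /=; have [-> ->] := position_div b r3. Qed.

Lemma tclockE b r : (r < 3)%N -> tclock (3 * b + r.+1) =
  match r with 0 => 0 | 1 => bvalue b | _ => 1 end.
Proof. by move=> r3; rewrite addnS /=; have [-> ->] := position_div b r3. Qed.

Lemma tdelayE b r : (r < 3)%N -> tdelay (3 * b + r.+1) =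
  match r with
  | 0 => bvalue b
  | 1 => 1 - bvalue b
  | _ => 7 - (weight tr (block b))%:R * (1 - bvalue b) - 2 * bvalue b.+1
  end.
Proof. by move=> r3; rewrite addnS /=; have [-> ->] := position_div b r3. Qed.

(** The wait in G is at least [7 - 4 - 2], as weights are at most 4 and values at most 1; this is
    where the size of the constant 7 matters. *)
Lemma tdelay_ge0 j : 0 <= tdelay j.
Proof.
case: j => // j; have [b [r [r3 ->]]] := position_cases (ltn0Sn j).
rewrite tdelayE //; have := bvalue_gt0 b; have := bvalue_le1 b.
case: r r3 => [|[|[|//]]] _; try lra.
have := bvalue_le1 b.+1; have := weight_cases tr (block b).
by rewrite !inE => /or3P[] /eqP ->; lra.
Qed.

Hypothesis start : sigma 0%N = (fun=> 0%N) /\ src (tr (tau 0%N)) = 0%N.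
Hypothesis step : forall m, (m < M)%N ->
  [/\ enabled (act (tr (tau m))) (sigma m),
      sigma m.+1 = apply_op (act (tr (tau m))) (sigma m)
    & dst (tr (tau m)) = src (tr (tau m.+1))].
Hypothesis src_last : src (tr (tau M)) = 2%N.
Hypothesis nop2 : forall t, src (tr t) = 2%N -> act (tr t) = ONop.
Hypothesis dst_gt0 : forall t, dst (tr t) != 0%N.

(** Program counter 0 occurs in round 0 only, as it is no target, and there all counters are 0. The
    hypothesis [step] stops before round [M], whose instruction is enabled as an [ONop]. *)
Lemma block_guard b : (b < M.+1 * K)%N -> csat (bvalue b) (guard tr (block b)).
Proof.
move=> bM; have mM : (b %/ K <= M)%N by rewrite -ltnS ltn_divLR.
have iK : (b %% K < K)%N by rewrite ltn_mod.
rewrite /guard /bvalue /=; set m := (b %/ K)%N in mM *; set i := (b %% K)%N in iK *.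
have := value_le1 R (sigma m i).
case: eqP => [src0|src0] le1.
  have m0 : m = 0%N.
    case: m mM src0 {le1} => // m mM.
    by have [_ _ <-] := step mM; have := dst_gt0 (tau m) => /eqP.
  by apply/value_eq1; rewrite m0; case: start => ->.
have en : enabled (act (tr (tau m))) (sigma m).
  move: mM; rewrite leq_eqVlt => /predU1P[->|mM]; first by rewrite nop2.
  by have [] := step mM.
case: (act _) en => [r|r|r|] //=; rewrite inordK //; case: eqP => //= ->.
  by rewrite value_lt1.
by move=> s0; apply/value_eq1.
Qed.

Lemma block_succ b : (b.+1 < M.+1 * K)%N -> next tr (block b) (block b.+1).
Proof.
move=> bM; rewrite /next /block /= !inordK ?ltn_mod //.
have bE := divn_eq b K; have iK : (b %% K < K)%N by rewrite ltn_mod.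
case: eqP => ik.
  have bE' : (b.+1 = (b %/ K).+1 * K + 0)%N by lia.
  have [d1 m1] : (b.+1 %/ K = (b %/ K).+1)%N /\ (b.+1 %% K = 0)%N.
    by rewrite {1 2}bE' addn0 mulnK // modnMl.
  rewrite d1 m1 /=; have mM : (b %/ K < M)%N.
    by rewrite -ltnS -d1 ltn_divLR.
  by have [_ _ ->] := step mM.
have i1K : ((b %% K).+1 < K)%N by lia.
have bE' : (b.+1 = b %/ K * K + (b %% K).+1)%N by lia.
have -> : (b.+1 %/ K = b %/ K)%N.
  by rewrite [in LHS]bE' divnMDl // (divn_small i1K) addn0.
have -> : (b.+1 %% K = (b %% K).+1)%N.
  by rewrite [in LHS]bE' modnMDl (modn_small i1K).
by rewrite !eqxx.
Qed.

Lemma tpath_machine : tpath None (@loc_edge T tr k) (3 * (M.+1 * K)) tloc tclock tdelay.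
Proof.
split=> // -[|j] jN; (split; first exact: tdelay_ge0).
  case: start => _ src0; exists (CAtom CGe 0), true; split=> //=.
  - by rewrite div0n mod0n src0 eqxx /= inordK.
  - by rewrite addr0.
have [b [r [r3 jE]]] := position_cases (ltn0Sn j).
rewrite jE in jN *; rewrite tlocE // tclockE // tdelayE // -addnS.
have b0 := bvalue_gt0 b; have b1 := bvalue_le1 b.
case: r r3 jE jN => [|[|[|//]]] _ jE jN.
- have bM : (b < M.+1 * K)%N by lia.
  exists (guard tr (block b)), false; rewrite tlocE // tclockE //= eqxx add0r.
  by split=> //; exact: block_guard.
- exists (CAtom CEq 1), false; rewrite tlocE // tclockE //= eqxx.
  by split=> //; lra.
- have bM : (b.+1 < M.+1 * K)%N by lia.
  exists (CAtom CGe 0), true; rewrite (_ : (3 * b + 4 = 3 * b.+1 + 1)%N); last by lia.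
  rewrite tlocE // tclockE //= block_succ //; split=> //.
  by rewrite addr_ge0 //; have := tdelay_ge0 (3 * b + 3); rewrite tdelayE.
Qed.

Lemma cost_block b :
  [/\ C (3 * b + 1) = 2 + 7 * b%:R - 2 * bvalue b, C (3 * b + 2) = 2 + 7 * b%:R
    & C (3 * b + 3) = 2 + 7 * b%:R + (weight tr (block b))%:R * (1 - bvalue b)].
Proof.
have C2 b' : C (3 * b' + 2) = C (3 * b' + 1) + 2 * bvalue b'.
  by rewrite [in LHS]addnS tcostS tlocE // tdelayE //= mulrC.
have C3 b' : C (3 * b' + 3) =
    C (3 * b' + 2) + (weight tr (block b'))%:R * (1 - bvalue b').
  by rewrite [in LHS]addnS tcostS tlocE // tdelayE //= mulrC.
suff CE : C (3 * b + 1) = 2 + 7 * b%:R - 2 * bvalue b.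
  by rewrite C3 C2 CE subrK.
elim: b => [|b IH].
  (* All counters start at 0, so [bvalue 0] is 1 and the claimed cost [2 - 2] is the zero cost of
     the initial location. *)
  rewrite tcostS /tcost big_ord0 /= /bvalue div0n mod0n.
  by case: start => -> _; rewrite (_ : value R 0 = 1) ?mulr0; [lra|apply/value_eq1].
rewrite (_ : (3 * b.+1 + 1 = (3 * b + 3).+1)%N); last by lia.
rewrite tcostS tlocE // tdelayE //= C3 C2 IH -natr1.
lra.
Qed.

Lemma bvalue_transfer b : (b < M * K)%N ->
  2 * bvalue (b + K) = (weight tr (block b))%:R * bvalue b.
Proof.
move=> bM; have mM : (b %/ K < M)%N by rewrite ltn_divLR.
have [en sE _] := step mM.
rewrite /bvalue /block divnDr ?dvdnn // divnn /= addn1 modnDr sE.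
have := value_apply R (inord (b %% K) : 'I_K) en.
by rewrite /= inordK // ltn_mod.
Qed.

Variable n : nat.
Hypothesis nM : (n.+1 < M)%N.
Hypothesis looping : forall m, (m <= n)%N -> dst (tr (tau m)) = 1%N.
Hypothesis leaving : src (tr (tau n.+1)) = 1%N /\ dst (tr (tau n.+1)) = 3%N.

Lemma tsat_machine :
  tsat (3 * (M.+1 * K)) (fun j => loc_label tr (tloc j)) C 0 (simulation_formula n k).
Proof.
have C0 : C 0 = 0 by rewrite /tcost big_ord0.
have nMK : (n.+1 * K < M * K)%N by rewrite ltn_mul2r.
apply/tsat_and; split.
  exists (3 * (n.+1 * K) + 2)%N; split.
  - by lia.
  - suff: 7%N \in loc_label tr (tloc (3 * (n.+1 * K) + 2)) by [].
    by rewrite lab7 tlocE //= mulnK //; case: leaving => -> ->.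
  - move=> j /andP[j0 je]; suff: 6%N \in loc_label tr (tloc j) by [].
    have [b [r [r3 jE]]] := position_cases j0; rewrite lab6 jE tlocE //=.
    have : (b %/ K <= n.+1)%N by rewrite -ltnS ltn_divLR //; lia.
    case: (b %/ K)%N => [|m]; first by case: start => _ ->.
    by move=> mn; have [_ _ <-] := step (ltac:(lia) : (m < M)%N); rewrite looping.
  - rewrite /= C0 subr0; have [_ -> _] := cost_block (n.+1 * K).
    by rewrite [(K * _)%N]mulnC [RHS]natrD [in RHS]natrM.
(* Halting is observed in the first block of round [M]. Obligations thus concern blocks of earlier
   rounds, and their linked blocks [b + K] still belong to the run, which has [M + 1] full
   rounds. *)
exists (3 * (M * K) + 1)%N; split.
- by lia.
- suff: 8%N \in loc_label tr (tloc (3 * (M * K) + 1)) by [].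
  by rewrite lab8 tlocE //= mulnK // src_last.
- move=> j /andP[j0 je]; apply/tsat_obligations.
  have [b [r [r3 jE]]] := position_cases j0.
  have bM : (b < M * K)%N by lia.
  have linkedE : r = 2%N -> linked (3 * (M.+1 * K)) (fun j => loc_label tr (tloc j))
      C j (7 * k + (7 - weight tr (block b))).
    move=> r2; exists (3 * (b + K) + 1)%N; split; [by lia|by rewrite lab0 tlocE|].
    have [-> _ _] := cost_block (b + K); have [_ _] := cost_block b.
    have -> : (7 * k + (7 - weight tr (block b)))%:R =
        7 * k%:R + (7 - (weight tr (block b))%:R) :> R.
      rewrite natrD natrM natrB //.
      by have := weight_cases tr (block b); rewrite !inE; lia.
    rewrite jE r2 => ->; rewrite bvalue_transfer //.
    by rewrite [(b + K)%:R]natrD -[K%:R]natr1; lra.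
  have labE w c : w \in [:: 1; 2; 4]%N -> (c = 7 * k + (7 - w))%N ->
      w.+1 \in loc_label tr (tloc j) -> linked (3 * (M.+1 * K))
        (fun j => loc_label tr (tloc j)) C j c.
    move=> w3 ->; rewrite lab_link // => H.
    rewrite jE tlocE // in H; move: H linkedE.
    by case: r r3 {jE} => [|[|[|//]]] _ //= /eqP -> linkedE; exact: linkedE.
  split; [|exact: (labE 1%N)|exact: (labE 2%N)|exact: (labE 4%N)].
  rewrite lab1 jE tlocE //; case: r r3 jE {linkedE} => [|[|[|//]]] _ jE //= _.
  exists (3 * b.+1 + 2)%N; split; [by lia|by rewrite lab1 tlocE| |].
  + move=> h bh; have : h = (3 * b + 3)%N \/ h = (3 * b.+1 + 1)%N by lia.
    by case=> ->; rewrite lab1 tlocE.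
  + have [_ -> _] := cost_block b.+1; have [_ -> _] := cost_block b.
    by rewrite -natr1; lra.
- rewrite /= C0 subr0; have [-> _ _] := cost_block (M * K).
  by have := bvalue_le1 (M * K); have : 0 <= (M * K)%:R :> R by []; lra.
Qed.

End Completeness.

Local Close Scope ring_scope.

(** * Diagonalization *)

Lemma realizable_accepting (R : realType) (T : finType) (tr : T -> instr) k n :
  (forall t, op_lt k.+1 (act (tr t))) ->
  (forall t, src (tr t) = 0 \/ src (tr t) = 2 -> act (tr t) = ONop) ->
  (forall t, dst (tr t) != 0) ->
  @wmtl_realizable R (machine_pta tr k, simulation_formula n k) <-> accepting tr n.
Proof.
move=> act_lt nop dst_gt0; rewrite realizable_mk_pta; split.
  case=> N [q [v [d [pth sat]]]]; apply: soundness pth _ sat act_lt _ dst_gt0.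
  by move=> t t0; apply: nop; left.
case=> M [tau [sigma [start step last [nM looping] leaving]]].
exists (3 * (M.+1 * k.+1)), (tloc k tau), (tclock R k sigma), (tdelay R tr k tau sigma).
split; first by apply: tpath_machine => // t t2; apply: nop; right.
exact: tsat_machine.
Qed.

(** * Computability of the formula *)

Section Wmtl.
Variables n : nat.
Implicit Type p q : n.-tuple nat -> wmtl.

Definition computable_wmtl p := computable (fun v => enc_wmtl (p v)).

Lemma computable_atom a : computable_wmtl (fun=> WAtom a).
Proof. exact: computable_const. Qed.

Lemma computable_not p : computable_wmtl p -> computable_wmtl (fun v => WNot (p v)).
Proof.
move=> cp; apply: computable_code_cons; first exact: computable_const.
by apply: computable_code_cons => //; exact: computable_const.
Qed.

Lemma computable_or p q : computable_wmtl p -> computable_wmtl q ->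
  computable_wmtl (fun v => WOr (p v) (q v)).
Proof.
move=> cp cq; apply: computable_code_cons; first exact: computable_const.
do 2!apply: computable_code_cons => //; exact: computable_const.
Qed.

Lemma computable_until p o (F : n.-tuple nat -> nat) q : computable_wmtl p ->
  computable F -> computable_wmtl q ->
  computable_wmtl (fun v => WUntil (p v) o (F v) (q v)).
Proof.
move=> cp cF cq; apply: computable_code_cons; first exact: computable_const.
apply: computable_code_cons => //.
apply: computable_code_cons; first exact: computable_const.
do 2!apply: computable_code_cons => //; exact: computable_const.
Qed.

Lemma computable_and p q : computable_wmtl p -> computable_wmtl q ->
  computable_wmtl (fun v => wand (p v) (q v)).
Proof. by move=> cp cq; apply/computable_not/computable_or; exact: computable_not. Qed.

Lemma computable_imp p q : computable_wmtl p -> computable_wmtl q ->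
  computable_wmtl (fun v => wimp (p v) (q v)).
Proof. by move=> cp cq; apply: computable_or => //; exact: computable_not. Qed.

Lemma computable_link a (F : n.-tuple nat -> nat) :
  computable F -> computable_wmtl (fun v => link a (F v)).
Proof.
move=> cF; apply: computable_imp; first exact: computable_atom.
apply: computable_until => //; last exact: computable_atom.
apply: computable_or; first exact: computable_atom.
exact/computable_not/computable_atom.
Qed.

End Wmtl.

(** When [n] is [enc_pta A], this is the code of the instance [(A, simulation_formula n k)]: one
    number serves as automaton and as input. *)
Definition enc_with_formula (n k : nat) : nat :=
  CodeSeq.code [:: n; enc_wmtl (simulation_formula n k)].

Lemma computable_simulation_formula :
  computable_wmtl (fun v : 2.-tuple nat => simulation_formula (nth 0 v 0) (nth 0 v 1)).
Proof.
have linkC a b : computable_wmtl (fun v : 2.-tuple nat => link a (7 * nth 0 v 1 + b)).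
  apply/computable_link/computable_add; last exact: computable_const.
  by apply: computable_mul; [exact: computable_const|exact: computable_nth].
rewrite /simulation_formula /obligations; apply: computable_and.
  apply: computable_until; try exact: computable_atom.
  apply: computable_add; first exact: computable_const.
  apply: computable_mul; first exact: computable_const.
  by apply: computable_mul; apply/computable_succ/computable_nth.
apply: computable_until; last exact: computable_atom; last exact: computable_const.
apply: computable_and; last first.
  apply: computable_and; [exact: linkC|apply: computable_and; exact: linkC].
apply: computable_imp; first exact: computable_atom.
apply: computable_until; last exact: computable_atom; last exact: computable_const.
exact/computable_not/computable_atom.
Qed.

Lemma computable_enc_with_formula :
  computable (fun v : 2.-tuple nat => enc_with_formula (nth 0 v 0) (nth 0 v 1)).
Proof.
rewrite /enc_with_formula; apply: computable_code_cons; first exact: computable_nth.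
apply: computable_code_cons; first exact: computable_simulation_formula.
exact: computable_const.
Qed.

(** * The machine around a program *)

Section Machine.
Variables (c : cmd) (n : nat).

Definition final_pc := 3 + csize c.

(** The program leaves its answer in register 2, and halting requires the answer 0. The self-loop at
    2 provides an instruction for the halting round. The loading loop is kept apart because it is
    nondeterministic. *)
Definition core : seq instr :=
  [:: Instr final_pc (OZero 2) 2; Instr 2 ONop 2] ++ flatten_cmd 3 c.

Definition instrs : seq instr :=
  [:: Instr 0 ONop 1; Instr 1 (OInc 0) 1; Instr 1 ONop 3] ++ core.

Definition instr_at (t : 'I_(size instrs)) : instr := tnth (in_tuple instrs) t.

Lemma instr_atP x : List.In x instrs <-> exists t, instr_at t = x.
Proof.
rewrite /instr_at; elim: instrs => [|y l IH] /=.
  by split=> // -[[]].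
split=> [[->|/IH[t <-]]|[t]].
- by exists ord0.
- by exists (lift ord0 t); rewrite !(tnth_nth x).
- case: (unliftP ord0 t) => [t' ->|->]; last by rewrite (tnth_nth x); left.
  by move=> tx; right; apply/IH; exists t'; rewrite -tx !(tnth_nth x).
Qed.

Lemma instr_at_in t : List.In (instr_at t) instrs.
Proof. by apply/instr_atP; exists t. Qed.

Lemma core_src x : List.In x core -> 2 <= src x.
Proof.
case=> [<-|[<-|/flatten_src]] //=; lia.
Qed.

Lemma core_dst x : List.In x core -> 2 <= dst x.
Proof.
case=> [<-|[<-|/flatten_dst]] //=; lia.
Qed.

Lemma deterministic_core : deterministic core.
Proof.
move=> t t' s; case=> [<-|[<-|T]] [<-|[<-|T']] //=.
- by have := flatten_src T'; rewrite /final_pc; lia.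
- by have := flatten_src T'; lia.
- by have := flatten_src T; rewrite /final_pc; lia.
- by have := flatten_src T; lia.
- by move=> e; exact: (deterministic_flatten T T' e).
Qed.

Lemma reach_core x y : 2 <= x.1 -> reach instrs x y -> reach core x y.
Proof.
move=> x2 R; elim: R x2 => [z|t s z tI en _ IH] /= t2; first exact: ReachRefl.
have tC : List.In t core by case: tI t2 => [<-|[<-|[<-|]]].
by apply: (ReachStep tC en); apply: IH; exact: core_dst.
Qed.

Lemma reach_halted x y : x.1 = 2 -> reach core x y -> y.1 = 2.
Proof.
move=> x2 R; apply: (reach_invariant (P := fun p => p = 2) _ R) => // t.
by case=> [<-|[<-|/flatten_src]] //=; lia.
Qed.

Definition input : store := upd (fun=> 0) 0 n.

Definition trace (M : nat) (tau : nat -> 'I_(size instrs)) (sigma : nat -> store) :=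
  forall m, m < M ->
    [/\ enabled (act (instr_at (tau m))) (sigma m),
        sigma m.+1 = apply_op (act (instr_at (tau m))) (sigma m)
      & dst (instr_at (tau m)) = src (instr_at (tau m.+1))].

Definition cons_fun (T : Type) (x : T) (f : nat -> T) : nat -> T :=
  fun m => if m is m'.+1 then f m' else x.

Lemma trace_cons t s M tau sigma : trace M tau sigma ->
  enabled (act (instr_at t)) s -> apply_op (act (instr_at t)) s = sigma 0 ->
  dst (instr_at t) = src (instr_at (tau 0)) ->
  trace M.+1 (cons_fun t tau) (cons_fun s sigma).
Proof. by move=> tr en ap dt [|m] //= mM; exact: tr. Qed.

Lemma trace_reach M tau sigma m : trace M tau sigma -> m <= M ->
  reach instrs (src (instr_at (tau m)), sigma m) (src (instr_at (tau M)), sigma M).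
Proof.
move=> tr mM; have [d dE] : exists d, M = m + d by exists (M - m); lia.
elim: d m mM dE => [|d IH] m mM dE; first by rewrite dE addn0; exact: ReachRefl.
have [en sE dt] := tr m (ltac:(lia)).
apply: (ReachStep (instr_at_in _) en).
by rewrite -sE dt; apply: IH; lia.
Qed.

Lemma reach_trace p s s' : reach instrs (p, s) (2, s') ->
  exists M tau sigma, [/\ trace M tau sigma, sigma 0 = s,
    src (instr_at (tau 0)) = p & src (instr_at (tau M)) = 2].
Proof.
move Ex: (p, s) => x; move Ey: (2, s') => y R.
elim: R p s Ex Ey => {x y} [x|t s1 y tI en _ IH] p s.
  move=> <- [<- _].
  have /instr_atP[t tE] : List.In (Instr 2 ONop 2) instrs by do 4!right; left.
  by exists 0, (fun=> t), (fun=> s); rewrite tE.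
case=> -> -> Ey; have [M [tau [sigma [tr s0 t0 tM]]]] := IH _ _ erefl Ey.
have /instr_atP[t' tE] := tI.
exists M.+1, (cons_fun t' tau), (cons_fun s1 sigma); split=> //=; last by rewrite tE.
by apply: trace_cons; rewrite ?tE.
Qed.

Lemma reach_accepting s' :
  reach instrs (3, input) (2, s') -> accepting instr_at n.
Proof.
move=> R.
have /instr_atP[t0 t0E] : List.In (Instr 0 ONop 1) instrs by left.
have /instr_atP[t1 t1E] : List.In (Instr 1 (OInc 0) 1) instrs by right; left.
have /instr_atP[t2 t2E] : List.In (Instr 1 ONop 3) instrs by do 2!right; left.
(* [d] counts the increments still to be done; rounds are prepended to the program's computation, so
   the induction runs backwards through the loading loop. *)
have [d dn] : exists d, d = n by exists n.
have : exists M tau sigma, [/\ trace M tau sigma, sigma 0 = upd (fun=> 0) 0 (n - d),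
    src (instr_at (tau 0)) = 1 /\ src (instr_at (tau M)) = 2,
    d < M /\ (forall m, m < d -> dst (instr_at (tau m)) = 1)
  & src (instr_at (tau d)) = 1 /\ dst (instr_at (tau d)) = 3].
  have : d <= n by rewrite dn.
  elim: d {dn} => [|d IH] dn.
    have [M [tau [sigma [tr s0 t0' tM]]]] := reach_trace R.
    exists M.+1, (cons_fun t2 tau), (cons_fun input sigma); rewrite /= t2E subn0.
    by split=> //; apply: trace_cons; rewrite ?t2E.
  have [M [tau [sigma [tr s0 [t0' tM] [dM ld] lv]]]] := IH (ltnW dn).
  exists M.+1, (cons_fun t1 tau), (cons_fun (upd (fun=> 0) 0 (n - d.+1)) sigma).
  rewrite /= t1E; split=> //.
  - apply: trace_cons; rewrite ?t1E //= s0; apply: funext => r.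
    by rewrite /upd eqxx; case: eqP => // _; lia.
  - by split=> // -[|m] //=; [rewrite t1E|exact: ld].
case=> M [tau [sigma [tr s0 [t0' tM] [dM ld] lv]]].
exists M.+1, (cons_fun t0 tau), (cons_fun (fun=> 0) sigma); rewrite -dn; split=> //=.
- by rewrite t0E.
- apply: trace_cons; rewrite ?t0E //= s0; apply: funext => r.
  by rewrite /upd dn subnn if_same.
- by split=> // -[|m] //=; [rewrite t0E|exact: ld].
Qed.

Lemma accepting_reach : accepting instr_at n ->
  exists s', reach instrs (3, input) (2, s').
Proof.
case=> M [tau [sigma [[s0 t0] tr tM [nM looping] [lv0 lv1]]]].
(* Round 0 increments nothing, so counter 0 is [m] only after round [m]. *)
have sigmaE m : m <= n -> sigma m.+1 = upd (fun=> 0) 0 m.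
  elim: m => [|m IH] mn.
    have [_ -> _] := tr 0 (ltac:(lia)); move: t0; case: (instr_at_in (tau 0)) => [<-|].
      by move=> _; rewrite s0; apply: funext => r; rewrite /upd if_same.
    by case=> [<-|[<-|/core_src]] //=; lia.
  have [_ -> _] := tr m.+1 (ltac:(lia)); rewrite IH; last by lia.
  have [_ _] := tr m (ltac:(lia)); rewrite looping; last by lia.
  have := looping m.+1 mn.
  case: (instr_at_in (tau m.+1)) => [<-|[<-|[<-|/core_src]]] //=; try lia.
  by move=> _ _; apply: funext => r; rewrite /upd eqxx; case: eqP.
have [_ sE] := tr n.+1 nM; rewrite lv1 => src3.
exists (sigma M).
have <- : sigma n.+2 = input.
  rewrite sE sigmaE //; move: lv0 lv1.
  by case: (instr_at_in (tau n.+1)) => [<-|[<-|[<-|/core_src]]] //=; lia.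
by have := trace_reach tr nM; rewrite -src3 tM.
Qed.

End Machine.

Fixpoint creg (c : cmd) : nat :=
  match c with
  | Skip => 0
  | Incr r => r.+1
  | Seq c1 c2 => maxn (creg c1) (creg c2)
  | Loop r c => maxn r.+1 (creg c)
  end.

Lemma flatten_op_lt b c m t : creg c <= m -> List.In t (flatten_cmd b c) ->
  op_lt m (act t).
Proof.
elim: c b => [|r|c1 IH1 c2 IH2|r c IH] b //=.
- by move=> rm [<-|].
- by rewrite geq_max => /andP[/IH1 H1 /IH2 H2] /List.in_app_iff[/H1|/H2].
- by rewrite geq_max => /andP[rm /IH H] [<-|[<-|[<-|/H]]].
Qed.

(* Register 1 receives the constant k, of which c may make use; this way k may
   depend on c. *)
Definition with_const (k : nat) (c : cmd) : cmd := iter k (Seq (Incr 1)) c.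

Lemma exec_with_const k c s s' : exec c (upd s 1 (s 1 + k)) s' ->
  exec (with_const k c) s s'.
Proof.
elim: k s => [|k IH] s E /=.
  by apply: exec_eq _ (fun=> erefl); move: E; congr exec; apply: funext => r; upds.
apply: ESeq (EIncr _ _) (IH _ _); move: E; congr exec.
by apply: funext => r; upds.
Qed.

Lemma creg_with_const k c : creg (with_const k c) <= maxn 2 (creg c).
Proof. by elim: k => [|k IH] /=; lia. Qed.

Theorem theorem3p11 (R : realType) :
  undecidable_problem enc_instance (@wmtl_realizable R).
Proof.
move=> [f fP]; have [g gP] := computable_enc_with_formula.
pose fg : recf 2 := RComp f (fun _ : 'I_1 => g).
(* Inputs [n] and [k] are in registers 0 and 1, the output in 2, scratch from 3 on. Loading [k] uses
   only register 1, so [k] bounds the registers of the final program whatever its own size; [k >= 2]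
   accommodates the test of register 2. *)
pose c0 := compile fg id 2 3; pose k := maxn 2 (creg c0).
pose c := with_const k c0; pose tr := @instr_at c.
(* The self-reference: the machine, which was built independently of [n], is run on the code of its
   own automaton. *)
pose A := machine_pta tr k; pose n := enc_pta A.
have realizableE : @wmtl_realizable R (A, simulation_formula n k) <-> accepting tr n.
  apply: realizable_accepting => t; have := instr_at_in t; rewrite -/tr.
  - case=> [<-|[<-|[<-|[<-|[<-|]]]]] //=; try lia.
    by apply: flatten_op_lt; apply: leq_trans (creg_with_const _ _) _; lia.
  - case=> [<-|[<-|[<-|[<-|[<-|/flatten_src]]]]] //=; rewrite ?/final_pc; lia.
  - by case=> [<-|[<-|[<-|/core_dst]]] //; case: (dst _).
have run y : eval f [tuple enc_instance (A, simulation_formula n k)] y ->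
    reach (instrs c) (3, input n) (final_pc c, upd (upd (input n) 1 k) 2 y).
  move=> ey; apply: reach_exec => [|t tc]; last by do 5!right.
  apply: exec_with_const; rewrite add0n.
  have ev : eval fg [tuple n; k] y.
    exists [tuple enc_instance (A, simulation_formula n k)]; split=> // i.
    by rewrite (tnth_nth 0) ord1; exact: (gP [tuple n; k]).
  apply: (compileP ev) => //.
  - by move=> i; have := ltn_ord i; lia.
  - by move=> [|[|r]].
  - by move=> [[|[|//]] i2]; rewrite (tnth_nth 0).
have [fP1 fP0] := fP (A, simulation_formula n k).
have [P|nP] := EM (@wmtl_realizable R (A, simulation_formula n k)).
(* If the instance is realizable, [f] answers 1 and the machine gets stuck at [final_pc]. It also
   halts, so by determinism the halting configuration would lead to [final_pc], but program counter
   2 is never left. *)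
- have [s' halt] := accepting_reach (proj1 realizableE P).
  have := run 1 (fP1 P) => /reach_core => /(_ isT) toE.
  have back : reach (core c) (2, s') (final_pc c, upd (upd (input n) 1 k) 2 1).
    apply: deterministic_reach (@deterministic_core c) toE (reach_core _ halt) _ => //.
    by move=> t; case=> [<-|[<-|/flatten_src]] //=; rewrite /final_pc; lia.
  by have := reach_halted (erefl 2 : (2, s').1 = 2) back; rewrite /= /final_pc; lia.
(* Otherwise [f] answers 0, the zero test succeeds and the machine halts, so the instance is
   realizable after all. *)
- apply/nP/realizableE; apply: reach_accepting.
  apply: reach_trans (run 0 (fP0 nP)) _.
  by apply: (@reach1 _ _ (OZero 2)) => //; do 3!right; left.
Qed.
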